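(* Let $d\ge1$, $0<\sigma<\infty$. Assume that for an interval $(a,b)\subset(0,\infty)$ the map $\omega\mapsto\varphi_\omega$ is continuous in the $l^2$ norm and all the waves $\varphi_\omega$, $\omega\in(a,b)$, are non-degenerate. Then the scalar function $\omega\mapsto\|\varphi_\omega\|_{l^2}$ is differentiable on $(a,b)$, and the wave $e^{i\omega t}\varphi_\omega$ is spectrally stable if and only if $$\partial_\omega\|\varphi_\omega\|_{l^2}^2\ge0.$$
   Context: The discrete Laplacian on $\mathbb Z^d$ is $(\Delta_{disc}\mathbf u)_n=\sum_{j\in\mathbb Z^d:|j-n|=1}u_j-2d\,u_n$. The focusing DNLS equation is $i\partial_tu_n+(\Delta_{disc}u)_n+|u_n|^{2\sigma}u_n=0$, $n\in\mathbb Z^d$. For $\omega>0$ and $\mathbf u\in l^2(\mathbb Z^d)$ let $J_\omega[\mathbf u]=\sum_{|j-n|=1}|u_j-u_n|^2+\omega\sum_n|u_n|^2$, the first sum running over unordered nearest-neighbour pairs (so it equals $\langle-\Delta_{disc}\mathbf u,\mathbf u\rangle$), and $j(\omega)=\inf\{J_\omega[\mathbf u]:\|\mathbf u\|_{l^{2\sigma+2}}=1\}>0$. The waves are $\varphi_\omega=j(\omega)^{\frac1{2\sigma}}\mathbf u_\omega$, where for each $\omega$, $\mathbf u_\omega$ is a minimizer with non-negative entries of $J_\omega$ subject to $\|\mathbf u\|_{l^{2\sigma+2}}=1$; they solve $-\Delta_{disc}\varphi+\omega\varphi-\varphi^{2\sigma+1}=0$. $\varphi_\omega$ is non-degenerate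 if $\mathrm{Ker}(-\Delta_{disc}+\omega-(2\sigma+1)\varphi_\omega^{2\sigma})=\{0\}$ in $l^2(\mathbb Z^d)$. Set $\mathcal L_+=-\Delta_{disc}+\omega-(2\sigma+1)\varphi_\omega^{2\sigma}$, $\mathcal L_-=-\Delta_{disc}+\omega-\varphi_\omega^{2\sigma}$. The wave $e^{i\omega t}\varphi_\omega$ is (spectrally) stable if $$\begin{pmatrix}0&-1\\1&0\end{pmatrix}\begin{pmatrix}\mathcal L_+&0\\0&\mathcal L_-\end{pmatrix}\mathbf v=\mu\,\mathbf v$$ has no non-trivial solution $(\mu,\mathbf v)$ with $\Re\mu>0$ and $\mathbf v\in l^2(\mathbb Z^d)\times l^2(\mathbb Z^d)$ (complex-valued). *)

(* Defs.v *)
From HB Require Import structures.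
From mathcomp Require Import all_boot all_order all_algebra.
From mathcomp Require Import all_classical all_reals all_analysis.
From mathcomp Require Import complex.
Set Implicit Arguments.
Unset Strict Implicit.
Unset Printing Implicit Defensive.
Import Order.TTheory GRing.Theory Num.Theory.
Import numFieldNormedType.Exports.
Local Open Scope classical_set_scope.
Local Open Scope complex_scope.
Local Open Scope ring_scope.

Definition lattice (d : nat) := 'rV[int]_d.

(* The Euclidean norm of j - n is 1. It is spelled out because the norm that
   the libraries put on row vectors is the sup norm. *)
Definition neighbours (d : nat) (j n : lattice d) : Prop :=
  \sum_(i < d) (j ord0 i - n ord0 i) ^+ 2 = 1.

Section Sequences.
Variables (R : realType) (d : nat).
Implicit Types (p omega : R) (u v : lattice d -> R[i]).

Definition modulus (z : R[i]) : R := complex.Re `|z|.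

Definition embed (f : lattice d -> R) : lattice d -> R[i] := fun n => (f n)%:C.

Definition lp_sum p u : \bar R :=
  \esum_(n in [set: lattice d]) (modulus (u n) `^ p)%:E.

Definition in_l2 u : Prop := (lp_sum 2 u < +oo)%E.

(* Meaningful only when [lp_sum p u] is finite; it is then the norm of u in
   l^p. This is the case for u in l^2 and p >= 2. *)
Definition lp_norm p u : R := fine (lp_sum p u) `^ p^-1.

(* [\sum_(j \in A)] ranges over a finite set: a site has 2d neighbours. *)
Definition laplacian u : lattice d -> R[i] := fun n =>
  \sum_(j \in [set j : lattice d | neighbours j n]) u j - (2 * d)%:R * u n.

(* The sum over unordered nearest-neighbour pairs is half of the sum over
   ordered ones. *)
Definition energy omega u : R :=
  fine (\esum_(e in [set e : lattice d * lattice d | neighbours e.1 e.2])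
          (modulus (u e.1 - u e.2) ^+ 2)%:E) / 2
  + omega * fine (\esum_(n in [set: lattice d]) (modulus (u n) ^+ 2)%:E).

Definition admissible (sigma : R) : set (lattice d -> R[i]) :=
  [set u | in_l2 u /\ lp_norm (2 * sigma + 2) u = 1].

Definition min_energy (sigma omega : R) : R :=
  inf [set energy omega u | u in admissible sigma].

Definition nonneg_minimizer (sigma omega : R) (f : lattice d -> R) : Prop :=
  [/\ admissible sigma (embed f),
      energy omega (embed f) = min_energy sigma omega
    & forall n, 0 <= f n].

Definition wave (sigma : R) (f : R -> lattice d -> R) (omega : R) :
    lattice d -> R :=
  fun n => min_energy sigma omega `^ (2 * sigma)^-1 * f omega n.

(* phi is the profile of the wave of frequency omega; Lplus and Lminus are the
   two diagonal blocks of the linearization about it, on complex sequences. *)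
Definition Lplus (sigma omega : R) (phi : lattice d -> R) v :
    lattice d -> R[i] := fun n =>
  - laplacian v n + omega%:C * v n
  - ((2 * sigma + 1) * phi n `^ (2 * sigma))%:C * v n.

Definition Lminus (sigma omega : R) (phi : lattice d -> R) v :
    lattice d -> R[i] := fun n =>
  - laplacian v n + omega%:C * v n - (phi n `^ (2 * sigma))%:C * v n.

Definition nondegenerate_wave (sigma omega : R) (phi : lattice d -> R) : Prop :=
  [set v | in_l2 v /\ Lplus sigma omega phi v = (fun=> 0)] = [set (fun=> 0)].

(* The two conditions after [(v1, v2) <> 0] are the rows of
   [[0, -1], [1, 0]] diag(Lplus, Lminus) (v1, v2) = mu (v1, v2). *)
Definition spectrally_stable (sigma omega : R) (phi : lattice d -> R) : Prop :=
  ~ exists (mu : R[i]) (v1 v2 : lattice d -> R[i]),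
    [/\ 0 < complex.Re mu, in_l2 v1 /\ in_l2 v2,
        (v1, v2) <> ((fun=> 0), (fun=> 0)),
        forall n, - Lminus sigma omega phi v2 n = mu * v1 n
      & forall n, Lplus sigma omega phi v1 n = mu * v2 n].

Definition l2_continuous_on (A : set R) (phi : R -> lattice d -> R) : Prop :=
  forall omega, A omega ->
    lp_norm 2 (fun n => embed (phi x) n - embed (phi omega) n)
      @[x --> omega] --> (0 : R).

End Sequences.

(* Main.v *)
Require Import Defs.
From HB Require Import structures.
From mathcomp Require Import all_boot all_order all_algebra.
From mathcomp Require Import all_classical all_reals all_analysis.
From mathcomp Require Import complex ring lra.
Set Implicit Arguments.
Unset Strict Implicit.
Unset Printing Implicit Defensive.
Import Order.TTheory GRing.Theory Num.Theory.
Import numFieldNormedType.Exports.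
Local Open Scope classical_set_scope.
Local Open Scope ring_scope.

(** The profile phi of the wave of frequency omega solves
    -Delta phi + omega phi = phi^(2 sigma + 1), and L+ is the derivative of
    this equation in phi. Suppose that L+ is injective. Since phi is square
    summable, the potentials of L+ and L- are small outside a finite set, so
    that both operators are coercive on a subspace of finite codimension. An
    injective symmetric operator with this property is bounded below and onto
    ([coercive_on_cat], [injective_bounded_below], [injective_surjective]); this
    is all the Fredholm theory that is needed, and it also takes the place of
    weak compactness.

    Let psi be the solution of L+ psi = phi. Differentiating the equation in
    omega gives L+ (d phi / d omega) = - phi, whence
    d |phi|^2 / d omega = - 2 <psi, phi> ([is_derive_sqr_norm]): the assumed
    continuity of the waves makes the remainder of the linearization negligible
    ([linearization_remainder]), and the lower bound on L+ then turns it into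
    differentiability. So the claim is that stability means <psi, phi> <= 0
    ([stable_wave]), the criterion of Vakhitov and Kolokolov.

    Minimality enters through the inequality J[w] >= j |w|^2, with |w| the norm
    of l^(2 sigma + 2) ([sobolev]). By Young's inequality it gives L- >= 0, and
    <L- phi, phi> = 0 then gives L- phi = 0, the equation of the wave
    ([lminus_ge0], [lminus_wave]). Its second-order expansion at the minimizer
    says that L+ >= 0 on the orthogonal complement of
    L+ phi = - 2 sigma phi^(2 sigma + 1) ([second_variation]). Finally phi > 0
    by the maximum principle, which also shows that phi spans the kernel of L-
    ([lminus_ker]).

    The rest is a statement about two symmetric operators ([vk_pair]). If
    <psi, phi> <= 0, the only negative direction of L+ is spent on psi, so that
    L+ >= 0 on the complement of phi ([lplus_form_ge0]); in an eigenvector with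
    Re mu > 0 both quadratic forms then have to vanish ([vk_stable]). If
    <psi, phi> > 0, L+ is negative somewhere on the complement of phi. The
    smallest lambda for which L- L+ L- + lambda L- >= 0 there is then positive,
    this operator has a kernel, and a kernel vector yields an eigenvector for
    the real eigenvalue sqrt lambda ([vk_unstable]). *)

(** * Hilbert spaces: Lax-Milgram, and coercivity from finite codimension *)

(** A complete real inner product space. Completeness is expressed with the
    squared norm, so that no square root occurs in the abstract arguments. *)
Record hilbert (R : realType) (V : lmodType R) := Hilbert {
  dot : V -> V -> R;
  dotC : forall x y, dot x y = dot y x;
  dotDl : forall x y z, dot (x + y) z = dot x z + dot y z;
  dotZl : forall a x y, dot (a *: x) y = a * dot x y;
  dot_gt0 : forall x, x != 0 -> 0 < dot x x;
  dot_complete : forall x_ : nat -> V,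
    (forall e : R, 0 < e -> exists N, forall m n, (N <= m)%N -> (N <= n)%N ->
       dot (x_ m - x_ n) (x_ m - x_ n) < e) ->
    exists l, forall e : R, 0 < e -> exists N, forall n, (N <= n)%N ->
      dot (x_ n - l) (x_ n - l) < e }.

Lemma discriminant_le0 (R : realFieldType) (a b c : R) :
  (forall t, 0 <= a + 2 * t * b + t ^+ 2 * c) -> b ^+ 2 <= a * c.
Proof.
move=> pos; have a0 : 0 <= a by have := pos 0; lra.
have [c0|c0|c0] := ltgtP 0 c.
- have := pos (- b / c).
  have -> : a + 2 * (- b / c) * b + (- b / c) ^+ 2 * c = (a * c - b ^+ 2) / c.
    by field; rewrite gt_eqF.
  by rewrite pmulr_lge0 ?invr_gt0// subr_ge0.
- exfalso; have := pos (1 + a + (2 * `|b| + 1) / - c).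
  set X := _ / - c; set T := 1 + a + X; have cT : 0 < - c by lra.
  have X0 : 0 < X.
    by rewrite divr_gt0//; have := normr_ge0 b; lra.
  have cX : - c * X = 2 * `|b| + 1.
    by rewrite mulrC divfK// gt_eqF.
  have T0 : 1 + a < T by rewrite /T; lra.
  have cTb : 2 * `|b| + 1 <= - c * T by rewrite /T mulrDr cX lerDr mulr_ge0//; lra.
  have T1 : 0 < T by lra.
  have := ler_wpM2l (ltW T1) cTb; have := ler_wpM2l (ltW T1) (ler_norm b).
  rewrite expr2; lra.
- rewrite -c0 mulr0; have [->|b0] := eqVneq b 0; first by rewrite expr0n.
  have := pos (- (a + 1) / (2 * b)).
  rewrite -c0 mulr0 addr0.
  have -> : a + 2 * (- (a + 1) / (2 * b)) * b = - 1 by field.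
  lra.
Qed.

Section Hilbert.
Variables (R : realType) (V : lmodType R) (H : hilbert V).
Implicit Types (x y z v w f g : V) (T : V -> V) (gs fs : seq V).
Local Notation "''[' x , y ]" := (dot H x y).

Lemma dotDr x y z : '[x, y + z] = '[x, y] + '[x, z].
Proof. by rewrite dotC dotDl !(dotC H x). Qed.

Lemma dotZr a x y : '[x, a *: y] = a * '[x, y].
Proof. by rewrite dotC dotZl dotC. Qed.

Lemma dotNl x y : '[- x, y] = - '[x, y].
Proof. by rewrite -scaleN1r dotZl mulN1r. Qed.

Lemma dotNr x y : '[x, - y] = - '[x, y].
Proof. by rewrite dotC dotNl dotC. Qed.

Lemma dotBl x y z : '[x - y, z] = '[x, z] - '[y, z].
Proof. by rewrite dotDl dotNl. Qed.

Lemma dotBr x y z : '[x, y - z] = '[x, y] - '[x, z].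
Proof. by rewrite dotDr dotNr. Qed.

Lemma dot0l x : '[0, x] = 0.
Proof. by rewrite -(scale0r 0) dotZl mul0r. Qed.

Lemma dot0r x : '[x, 0] = 0.
Proof. by rewrite dotC dot0l. Qed.

Lemma dot_ge0 x : 0 <= '[x, x].
Proof.
by have [->|/(dot_gt0 H)/ltW//] := eqVneq x 0; rewrite dot0l.
Qed.

Lemma dot_self_eq0 x : '[x, x] = 0 -> x = 0.
Proof.
by move=> xx; apply: contraTeq isT => /(dot_gt0 H); rewrite xx ltxx.
Qed.

Lemma dot_inj x y : (forall z, '[x, z] = '[y, z]) -> x = y.
Proof.
move=> xy; apply/eqP; rewrite -subr_eq0; apply/eqP/dot_self_eq0.
by rewrite dotBl xy subrr.
Qed.

Definition dotE := (dotDl, dotDr, dotZl, dotZr, dotNl, dotNr, dot0l, dot0r).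

Lemma dot_schwarz x y : '[x, y] ^+ 2 <= '[x, x] * '[y, y].
Proof.
apply: discriminant_le0 => t.
have := dot_ge0 (x + t *: y); rewrite !dotE (dotC H y x).
by congr (_ <= _); ring.
Qed.

Lemma dot_sub_le x y : '[x, x] <= 2 * '[x - y, x - y] + 2 * '[y, y].
Proof.
have := dot_ge0 (x - 2 *: y); rewrite !dotE (dotC H y x).
lra.
Qed.

Definition symmetric_op T := forall x y, '[T x, y] = '[x, T y].

Lemma symD T : symmetric_op T -> {morph T : x y / x + y}.
Proof. by move=> sT x y; apply: dot_inj => z; rewrite sT !dotE !sT. Qed.

Lemma symZ T a : symmetric_op T -> {morph T : x / a *: x}.
Proof. by move=> sT x; apply: dot_inj => z; rewrite sT !dotE !sT. Qed.

Lemma symN T : symmetric_op T -> {morph T : x / - x}.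
Proof. by move=> sT x; rewrite -scaleN1r symZ// scaleN1r. Qed.

Lemma sym0 T : symmetric_op T -> T 0 = 0.
Proof. by move=> sT; have := symZ 0 sT 0; rewrite !scale0r. Qed.

(** The closed subspaces of finite codimension on which forms are studied. *)
Definition annihilator gs v := forall g, g \in gs -> '[g, v] = 0.

Lemma annihilatorD gs x y :
  annihilator gs x -> annihilator gs y -> annihilator gs (x + y).
Proof. by move=> wx wy g gg; rewrite dotE wx// wy// addr0. Qed.

Lemma annihilatorZ gs a x : annihilator gs x -> annihilator gs (a *: x).
Proof. by move=> wx g gg; rewrite dotE wx// mulr0. Qed.

Lemma annihilator_cons g gs x :
  annihilator (g :: gs) x <-> '[g, x] = 0 /\ annihilator gs x.
Proof.
split=> [wx|[gx wx] h]; last by rewrite inE => /predU1P[->|/wx].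
by split=> [|h hg]; apply: wx; rewrite inE ?eqxx// hg orbT.
Qed.

Definition coercive_on gs T :=
  exists2 c : R, 0 < c & forall v, annihilator gs v -> c * '[v, v] <= '[T v, v].

Lemma form_schwarz gs T x y : symmetric_op T ->
  (forall v, annihilator gs v -> 0 <= '[T v, v]) ->
  annihilator gs x -> annihilator gs y ->
  '[T x, y] ^+ 2 <= '[T x, x] * '[T y, y].
Proof.
move=> sT pos wx wy; apply: discriminant_le0 => t.
have := pos _ (annihilatorD wx (annihilatorZ t wy)).
rewrite symD// symZ// !dotE (sT y x) (dotC H y).
by congr (_ <= _); ring.
Qed.

(** The solution minimizes E v = <T v, v> - 2 <f, v>: a minimizing sequence is
    Cauchy by the parallelogram identity and coercivity, and for each point of
    the sequence the defect <T w, y> - <f, y> is controlled by E w - inf E, so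
    that the equation passes to the limit by weak continuity alone. *)
Lemma lax_milgram gs T f : symmetric_op T -> coercive_on gs T ->
  exists2 w, annihilator gs w &
    forall y, annihilator gs y -> '[T w, y] = '[f, y].
Proof.
move=> sT [c c0 cT]; pose E v := '[T v, v] - 2 * '[f, v].
have E_lb v : annihilator gs v -> - ('[f, f] / c) <= E v.
  move=> /cT; rewrite /E; have := dot_ge0 (c *: v - f).
  rewrite !dotE (dotC H v f) => h1 h2.
  rewrite -subr_ge0 opprK -(pmulr_rge0 _ c0) mulrDr mulrCA divff ?gt_eqF// mulr1.
  nra.
pose A := [set E v | v in annihilator gs].
have A0 : has_inf A.
  split; first by exists (E 0), 0 => // g _; rewrite dotE.
  by exists (- ('[f, f] / c)) => _ [v /E_lb ? <-].
have E_ge v : annihilator gs v -> inf A <= E v.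
  by move=> wv; apply: ge_inf; [case: A0|exists v].
have /choice[w_ w_P] : forall k : nat, exists v, annihilator gs v /\
    E v < inf A + k.+1%:R^-1.
  move=> k; have k0 : 0 < k.+1%:R^-1 :> R by rewrite invr_gt0.
  by have [_ [v wv <-] ?] := inf_adherent k0 A0; exists v.
have wW k : annihilator gs (w_ k) by have [] := w_P k.
have wE k : E (w_ k) < inf A + k.+1%:R^-1 by have [] := w_P k.
have small (e : R) : 0 < e -> exists N, forall n, (N <= n)%N -> n.+1%:R^-1 < e :> R.
  move=> e0; have [N _ HN] := near_infty_natSinv_lt (PosNum e0).
  by exists N => n /HN.
have w_cauchy (e : R) : 0 < e -> exists N, forall m n, (N <= m)%N -> (N <= n)%N ->
    '[w_ m - w_ n, w_ m - w_ n] < e.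
  move=> e0; have [|N HN] := small (c * e / 4); first by rewrite divr_gt0// mulr_gt0.
  exists N => m n /HN mN /HN nN.
  have wmn := annihilatorZ 2^-1 (annihilatorD (wW m) (wW n)).
  have := E_ge _ wmn.
  have wB := annihilatorD (wW m) (annihilatorZ (- 1) (wW n)).
  rewrite -scaleN1r.
  have := cT _ wB; have := wE m; have := wE n.
  set bb := '[_ + _, _].
  rewrite /E !(symD sT, symZ _ sT, dotE) (sT (w_ n) (w_ m)) (dotC H (w_ n)).
  set a := '[T (w_ n), w_ n]; set b := '[T (w_ m), w_ m].
  set d := '[T (w_ m), w_ n]; set p := '[f, _]; set q := '[f, _].
  move=> h1 h2 h3 h4.
  rewrite -(ltr_pM2l c0).
  move: mN nN h1 h2; set im := m.+1%:R^-1; set i_n := n.+1%:R^-1.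
  move: im i_n => im i_n; lra.
have [l l_lim] := dot_complete w_cauchy.
have lW : annihilator gs l.
  move=> g gg; apply/eqP; rewrite -sqrf_eq0 eq_le sqr_ge0 andbT.
  apply/ler_addgt0Pr => e e0; rewrite add0r.
  have [|N HN] := l_lim (e / ('[g, g] + 1)).
    by rewrite divr_gt0// ltr_wpDl ?dot_ge0.
  have := HN N (leqnn _); rewrite ltr_pdivlMr ?ltr_wpDl ?dot_ge0// => hN.
  have := dot_schwarz g (w_ N - l); rewrite dotBr wW// sub0r sqrrN.
  have := dot_ge0 (w_ N - l); have := dot_ge0 g; nra.
exists l => // y wy; apply/eqP; rewrite -subr_eq0 -sqrf_eq0 eq_le sqr_ge0 andbT.
apply/ler_addgt0Pr => e e0; rewrite add0r.
set K := 2 * '[T y, T y] + 2 * '[T y, y] + 1.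
have Ty : 0 <= '[T y, y] by apply: le_trans (cT _ wy); rewrite mulr_ge0 ?dot_ge0 ?ltW.
have K0 : 0 < K by rewrite /K; have := dot_ge0 (T y); lra.
have eK : 0 < e / K by rewrite divr_gt0.
have [N1 HN1] := small _ eK.
have [N2 HN2] := l_lim _ eK.
set N := maxn N1 N2.
have h1 := HN1 N (leq_maxl _ _); have h2 := HN2 N (leq_maxr _ _).
(* E is within E (w_ N) - inf A of its infimum along the line w_ N + t y *)
have h3 : ('[T (w_ N), y] - '[f, y]) ^+ 2 <= (E (w_ N) - inf A) * '[T y, y].
  apply: discriminant_le0 => t.
  have := E_ge _ (annihilatorD (wW N) (annihilatorZ t wy)).
  rewrite /E !(symD sT, symZ _ sT, dotE) (sT y (w_ N)) (dotC H y (T _)).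
  by rewrite -subr_ge0; congr (_ <= _); ring.
have h4 := dot_schwarz (T y) (w_ N - l).
have -> : '[T l, y] - '[f, y] =
    ('[T (w_ N), y] - '[f, y]) - '[T y, w_ N - l].
  by rewrite !dotE sT (sT (w_ N)) ![in RHS](dotC H (T y)); ring.
move: h3 h4; set X := _ - _; set Y := '[T y, w_ N - l] => h3 h4.
have h5 := wE N.
have h6 : e / K * K = e by rewrite divfK// gt_eqF.
have h7 : X ^+ 2 <= e / K * '[T y, y].
  apply: le_trans h3 _; rewrite ler_wpM2r//.
  by rewrite lerBlDl ltW// (lt_trans h5)// ltrD2l.
have h8 : Y ^+ 2 <= e / K * '[T y, T y].
  by apply: le_trans h4 _; rewrite mulrC ler_wpM2r ?dot_ge0// ltW.
have h9 : (X - Y) ^+ 2 <= 2 * X ^+ 2 + 2 * Y ^+ 2.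
  by rewrite -subr_ge0; have := sqr_ge0 (X + Y); congr (_ <= _); ring.
rewrite -h6 /K; set k := e / K in h6 h7 h8 eK *.
lra.
Qed.

(** One linear constraint can be dropped. The form splits orthogonally along z,
    the point of the hyperplane <g, z> = 1 at which the form is minimal: there
    it is positive by hypothesis, and the complement of z is the smaller
    subspace. *)
Lemma coercive_on_cons g fs T : symmetric_op T ->
  (forall v, annihilator fs v -> v != 0 -> 0 < '[T v, v]) ->
  coercive_on (g :: fs) T -> coercive_on fs T.
Proof.
move=> sT pos coT.
have [[e [we ge]]|noe] := pselect (exists e, annihilator fs e /\ '[g, e] <> 0);
    last first.
  case: coT => c c0 cT; exists c => // v wv; apply: cT.
  apply/annihilator_cons; split=> //; apply: contrapT => gv.
  by apply: noe; exists v.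
have [w /annihilator_cons[gw ww] hw] := lax_milgram (- T e) sT coT.
pose z := '[g, e]^-1 *: (e + w).
have wz : annihilator fs z by exact/annihilatorZ/annihilatorD.
have gz : '[g, z] = 1 by rewrite /z !dotE gw addr0 mulVf//; apply/eqP.
have Tz y : annihilator (g :: fs) y -> '[T z, y] = 0.
  by move=> /hw h; rewrite /z symZ// symD// !dotE h !dotE subrr mulr0.
clearbody z; have z0 : z != 0.
  by apply/eqP => z0; move: gz; rewrite z0 dot0r => /esym/eqP; rewrite oner_eq0.
have m0 := pos z wz z0.
have zz := dot_gt0 H z0.
case: coT => c c0 cT.
exists (Num.min ('[T z, z] / (2 * '[z, z])) (c / 2)).
  by rewrite lt_min !divr_gt0// mulr_gt0.
move=> v wv; set c' := Num.min _ _.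
pose s := '[g, v]; pose y := v - s *: z.
have wy : annihilator (g :: fs) y.
  apply/annihilator_cons; split; first by rewrite /y !dotE gz mulr1 subrr.
  by rewrite /y -scaleNr; exact/annihilatorD/annihilatorZ.
have vE : v = s *: z + y by rewrite /y addrC subrK.
clearbody y.
have := cT _ wy; have := Tz _ wy.
have c1 : c' * (2 * '[z, z]) <= '[T z, z].
  by rewrite -ler_pdivlMr ?mulr_gt0// /c' ge_min lexx.
have c2 : c' <= c / 2 by rewrite /c' ge_min lexx orbT.
have c'0 : 0 < c' by rewrite lt_min !divr_gt0// mulr_gt0.
rewrite vE !(symD sT, symZ _ sT, dotE) (sT y z) (dotC H y (T z)) (dotC H y z).
move=> -> h.
have := dot_ge0 (s *: z - y); rewrite !dotE (dotC H y z).
have := dot_ge0 y; have := sqr_ge0 s.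
move: h c1; set a := '[z, z]; set b := '[y, y]; set d := '[z, y].
set m := '[T z, z]; set n := '[T y, y] => h1 h2 h3 h4 h5.
have h6 : c' * (s * (s * a + d) + (s * d + b)) <= c' * (2 * s ^+ 2 * a + 2 * b).
  rewrite ler_pM2l//; lra.
have h7 : c' * b <= c / 2 * b by rewrite ler_wpM2r.
have h8 : s ^+ 2 * (c' * (2 * a)) <= s ^+ 2 * m by rewrite ler_wpM2l.
rewrite !(mulrDr s, mulrDl, mulr0, addr0, add0r) in h6 *.
lra.
Qed.

(** A form that is positive, and coercive in finite codimension, is coercive.
    This stands in for the compactness argument that the infimum of the form on
    the unit sphere is attained. *)
Lemma coercive_on_cat gs fs T : symmetric_op T ->
  (forall v, annihilator fs v -> v != 0 -> 0 < '[T v, v]) ->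
  coercive_on (gs ++ fs) T -> coercive_on fs T.
Proof.
move=> sT pos; elim: gs => //= g gs IH /coercive_on_cons h.
apply/IH/h => // v wv; apply: pos => x xf; apply: wv.
by rewrite mem_cat xf orbT.
Qed.

End Hilbert.

(** * The stability criterion for a pair of symmetric operators *)

Section Symmetric.
Variables (R : realType) (V : lmodType R) (H : hilbert V).
Implicit Types (x y z v w f g : V) (T : V -> V) (gs fs : seq V).
Local Notation "''[' x , y ]" := (dot H x y).

Definition bounded_op T := exists K : R, forall v, '[T v, T v] <= K * '[v, v].

Lemma bounded_form T : bounded_op T ->
  exists2 C : R, 0 < C & forall v, `|'[T v, v]| <= C * '[v, v].
Proof.
case=> K TK; exists (`|K| + 1) => [|v]; first by rewrite ltr_wpDl.
have := TK v; have := dot_ge0 H (T v - v); have := dot_ge0 H (T v + v).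
rewrite !dotE (dotC H v (T v)) ler_norml.
have := ler_wpM2r (dot_ge0 H v) (ler_norm K).
have := mulr_ge0 (normr_ge0 K) (dot_ge0 H v).
rewrite mulrDl mul1r; move: (dot_ge0 H v) => *; apply/andP; split; lra.
Qed.

Lemma coercive_bounded_below gs T : coercive_on H gs T ->
  exists2 c : R, 0 < c &
    forall v, annihilator H gs v -> c * '[v, v] <= '[T v, T v].
Proof.
case=> c c0 cT; exists (c ^+ 2) => [|v /cT h]; first by rewrite exprn_gt0.
have := dot_ge0 H (T v - c *: v); rewrite !dotE (dotC H v (T v)).
have := ler_wpM2l (ltW c0) h; rewrite expr2; lra.
Qed.

Lemma annihilator0 v : annihilator H [::] v.
Proof. by move=> g. Qed.
#[local] Hint Resolve annihilator0 : core.

Lemma annihilator1 f v : annihilator H [:: f] v <-> '[f, v] = 0.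
Proof.
by rewrite annihilator_cons; split=> [[]//|]; split.
Qed.

(** T itself need not be positive; its square is, and has the same kernel. *)
Lemma square_coercive gs T : symmetric_op H T -> coercive_on H gs T ->
  (forall v, T v = 0 -> v = 0) -> coercive_on H [::] (T \o T).
Proof.
move=> sT coT injT; have sTT : symmetric_op H (T \o T).
  by move=> x y; rewrite /= !sT.
apply: (@coercive_on_cat _ _ _ gs) => //.
  move=> v _ v0; rewrite /= sT dot_gt0//.
  by apply: contra_neq v0 => /injT.
rewrite cats0; have [c c0 cT] := coercive_bounded_below coT.
by exists c => // v wv; rewrite /= sT; exact: cT.
Qed.

Lemma injective_bounded_below gs T : symmetric_op H T -> coercive_on H gs T ->
  (forall v, T v = 0 -> v = 0) ->
  exists2 c : R, 0 < c & forall v, c * '[v, v] <= '[T v, T v].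
Proof.
move=> sT coT injT; have [c c0 cT] := square_coercive sT coT injT.
by exists c => // v; rewrite -sT; exact: cT.
Qed.

Lemma injective_surjective gs T f : symmetric_op H T -> coercive_on H gs T ->
  (forall v, T v = 0 -> v = 0) -> exists v, T v = f.
Proof.
move=> sT coT injT.
have sTT : symmetric_op H (T \o T) by move=> x y; rewrite /= !sT.
have [w _ hw] := lax_milgram f sTT (square_coercive sT coT injT).
by exists (T w); apply: (@dot_inj _ _ H) => y; exact: hw.
Qed.

Lemma psd_ker T v : symmetric_op H T -> (forall w, 0 <= '[T w, w]) ->
  '[T v, v] = 0 -> T v = 0.
Proof.
move=> sT T0 v0; apply: (@dot_inj _ _ H) => y; rewrite dot0l.
have := @form_schwarz _ _ H [::] _ v y sT (fun w _ => T0 w).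
move=> /(_ (annihilator0 _) (annihilator0 _)); rewrite v0 mul0r.
by move=> h; apply/eqP; rewrite -sqrf_eq0 eq_le h sqr_ge0.
Qed.

(** What the criterion uses of the linearization about a wave phi: Lp and Lm
    are L+ and L-, the fields on tails say that both are coercive in finite
    codimension, and [vk_ge0p] says that L+ has at most one negative
    direction. *)
Record vk_pair (Lp Lm : V -> V) (phi : V) : Prop := VkPair {
  vk_symp : symmetric_op H Lp;
  vk_symm : symmetric_op H Lm;
  vk_bndp : bounded_op Lp;
  vk_bndm : bounded_op Lm;
  vk_tailp : exists gs, coercive_on H gs Lp;
  vk_tailm : exists gs, coercive_on H gs Lm;
  vk_injp : forall v, Lp v = 0 -> v = 0;
  vk_phi : phi != 0;
  vk_ge0m : forall v, 0 <= '[Lm v, v];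
  vk_phim : Lm phi = 0;
  vk_kerm : forall v, '[phi, v] = 0 -> Lm v = 0 -> v = 0;
  vk_ge0p : forall v, '[Lp phi, v] = 0 -> 0 <= '[Lp v, v];
  vk_phip : '[Lp phi, phi] <= 0 }.

Section VK.
Variables (Lp Lm : V -> V) (phi psi : V).

Lemma nonneg_form_ker v : vk_pair Lp Lm phi -> '[Lm v, v] = 0 -> Lm v = 0.
Proof. by move=> vk; apply: psd_ker; [exact: vk_symm vk|exact: vk_ge0m vk]. Qed.

Lemma vk_coercivem : vk_pair Lp Lm phi -> coercive_on H [:: phi] Lm.
Proof.
move=> vk; have [gs [c c0 cT]] := vk_tailm vk.
apply: (@coercive_on_cat _ _ _ gs) (vk_symm vk) _ _.
  move=> v /annihilator1 pv v0; rewrite lt_def (vk_ge0m vk) andbT.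
  by apply: contra_neq v0 => /(nonneg_form_ker vk)/(vk_kerm vk pv).
by exists c => // v wv; apply: cT => g gg; apply: wv; rewrite mem_cat gg.
Qed.

(** The vector x = |phi|^2 v - <L+ phi, v> psi satisfies <L+ phi, x> = 0, and
    for v orthogonal to phi its form is
    <L+ x, x> = |phi|^4 <L+ v, v> + <L+ phi, v>^2 <psi, phi>. *)
Lemma lplus_form_ge0 v : vk_pair Lp Lm phi -> Lp psi = phi -> '[psi, phi] <= 0 ->
  '[phi, v] = 0 -> 0 <= '[Lp v, v].
Proof.
move=> vk psiE D0 pv; have pp := dot_gt0 H (vk_phi vk).
have sP := vk_symp vk.
have := vk_ge0p vk (v := '[phi, phi] *: v - '[Lp phi, v] *: psi).
rewrite !(symD sP, symZ _ sP, symN sP, dotE) psiE (sP phi psi) psiE pv.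
rewrite (sP v psi) psiE (dotC H v phi) pv (dotC H phi psi).
set a := '[phi, phi] in pp *; set b := '[Lp phi, v]; set D := '[psi, phi] in D0 *.
move=> h; have {}h : 0 <= a ^+ 2 * '[Lp v, v] + b ^+ 2 * D.
  apply: (le_trans (h _)); first by ring.
  by rewrite le_eqVlt; apply/orP; left; apply/eqP; ring.
have : 0 <= a ^+ 2 * '[Lp v, v].
  by have := mulr_ge0_le0 (sqr_ge0 b) D0; lra.
by rewrite pmulr_rge0// exprn_gt0.
Qed.

(** The eigenvalue is m + i k and the eigenvector (a + i b, c + i d). Its first
    component is orthogonal to phi, since phi is in the kernel of L-. With
    X = <a, c> + <b, d> and Y = <c, b> - <d, a>, the symmetry of L+ and of L-
    gives m Y = k X and m Y = - k X, and the nonnegative forms of the two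
    components are m X + k Y and - m X + k Y; hence X = Y = 0 and both forms
    vanish. *)
Theorem vk_stable (m k : R) (a b c d : V) : vk_pair Lp Lm phi ->
  Lp psi = phi -> '[psi, phi] <= 0 -> 0 < m ->
  Lm c = - (m *: a - k *: b) -> Lm d = - (k *: a + m *: b) ->
  Lp a = m *: c - k *: d -> Lp b = k *: c + m *: d ->
  [/\ a = 0, b = 0, c = 0 & d = 0].
Proof.
move=> vk psiE D0 m0 Lc Ld La Lb.
have [sP sM] := (vk_symp vk, vk_symm vk).
have m2 : 0 < m ^+ 2 + k ^+ 2 by rewrite ltr_pwDl ?sqr_ge0// exprn_gt0.
(* (m + i k) (x + i y) = 0 has only the zero solution *)
have solve (x y : R) : m * x - k * y = 0 -> k * x + m * y = 0 ->
    x = 0 /\ y = 0.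
  move=> e1 e2; split; apply: (mulfI (lt0r_neq0 m2)); rewrite mulr0.
    transitivity (m * (m * x - k * y) + k * (k * x + m * y)); first by ring.
    by rewrite e1 e2; ring.
  transitivity (m * (k * x + m * y) - k * (m * x - k * y)); first by ring.
  by rewrite e1 e2; ring.
have solveV (x y : V) : m *: x - k *: y = 0 -> k *: x + m *: y = 0 ->
    x = 0 /\ y = 0.
  move=> e1 e2; have h z : '[x, z] = 0 /\ '[y, z] = 0.
    apply: solve.
      by rewrite -!dotZl -dotBl e1 dot0l.
    by rewrite -!dotZl -dotDl e2 dot0l.
  by split; apply: (@dot_inj _ _ H) => z; rewrite dot0l; case: (h z).
have [pa pb] : '[phi, a] = 0 /\ '[phi, b] = 0.
  apply: solve.
    by rewrite -!dotZr -dotBr -[_ - _]opprK -Lc dotNr -sM (vk_phim vk) dot0l oppr0.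
  by rewrite -!dotZr -dotDr -[_ + _]opprK -Ld dotNr -sM (vk_phim vk) dot0l oppr0.
have [qc qd] : '[Lm c, c] = 0 /\ '[Lm d, d] = 0.
  have := lplus_form_ge0 vk psiE D0 pa; have := lplus_form_ge0 vk psiE D0 pb.
  have := sP a b; have := sM c d.
  have := vk_ge0m vk c; have := vk_ge0m vk d.
  rewrite La Lb Lc Ld !dotE.
  rewrite (dotC H a c) (dotC H a d) (dotC H b c) (dotC H b d).
  set X1 := '[c, a]; set X2 := '[d, b]; set Y1 := '[c, b]; set Y2 := '[d, a].
  move=> hd hc sc sd hb ha.
  have mY : m * (Y1 - Y2) = 0 by lra.
  have /eqP := mY; rewrite mulf_eq0 gt_eqF//= => /eqP Y0.
  have kY : k * (Y1 - Y2) = 0 by rewrite Y0 mulr0.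
  by split; lra.
have Lc0 := nonneg_form_ker vk qc; have Ld0 := nonneg_form_ker vk qd.
have [a0 b0] : a = 0 /\ b = 0.
  apply: solveV; apply/oppr_inj; rewrite oppr0.
    by rewrite -Lc.
  by rewrite -Ld.
have [c0 d0] : c = 0 /\ d = 0.
  apply: solveV; first by rewrite -La a0 (sym0 sP).
  by rewrite -Lb b0 (sym0 sP).
by [].
Qed.

(** Let T l = L- L+ L- + l L- and let ls be the least l >= 0 for which T l is
    nonnegative on the complement of phi. It is finite because
    |L- w|^2 <= C <L- w, w>, and positive because L- maps this complement onto
    itself while L+ is negative at v = phi - s psi. If T ls were definite it
    would be coercive, and ls could be lowered. So T ls w = 0 for some w
    orthogonal to phi; then L+ L- w + ls w is a multiple k phi, which is the
    eigenvalue equation for v1 = L- w and mu v2 = k phi - ls w. *)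
Theorem vk_unstable : vk_pair Lp Lm phi ->
  Lp psi = phi -> 0 < '[psi, phi] ->
  exists (mu : R) (v1 v2 : V),
    [/\ 0 < mu, v1 != 0, - Lm v2 = mu *: v1 & Lp v1 = mu *: v2].
Proof.
move=> vk psiE D0; have pp := dot_gt0 H (vk_phi vk).
have [sP sM] := (vk_symp vk, vk_symm vk).
have [c c0 cM] := vk_coercivem vk.
have [Cp Cp0 hCp] := bounded_form (vk_bndp vk).
have [Cm Cm0 hCm] := bounded_form (vk_bndm vk).
have LmLm w : '[Lm w, Lm w] <= Cm * '[Lm w, w].
  have := @form_schwarz _ _ H [::] _ w (Lm w) sM (fun v _ => vk_ge0m vk v).
  move=> /(_ (annihilator0 _) (annihilator0 _)) h.
  have := le_trans h (ler_wpM2l (vk_ge0m vk w) (le_trans (ler_norm _) (hCm _))).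
  have [->|n0] := eqVneq (Lm w) 0; first by rewrite !dot0l mulr0.
  by rewrite mulrCA mulrA expr2 ler_pM2r// dot_gt0.
pose T (l : R) w := Lm (Lp (Lm w)) + l *: Lm w.
have sT l : symmetric_op H (T l).
  by move=> x y; rewrite /T !dotE sM sP sM sM.
have TE l w : '[T l w, w] = '[Lp (Lm w), Lm w] + l * '[Lm w, w].
  by rewrite /T !dotE sM.
pose S := [set l : R | 0 <= l /\ forall w, '[phi, w] = 0 -> 0 <= '[T l w, w]].
have S_inf : has_inf S.
  split; last by exists 0 => l [].
  exists (Cp * Cm); split=> [|w _]; first by rewrite mulr_ge0// ltW.
  rewrite TE -mulrA; have := hCp (Lm w); rewrite ler_norml => /andP[h _].
  by have := ler_wpM2l (ltW Cp0) (LmLm w); lra.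
set ls := inf S.
have ls_le l : S l -> ls <= l by move=> Sl; apply: ge_inf => //; case: S_inf.
have ls0 : 0 <= ls by apply: lb_le_inf => [|l []//]; case: S_inf.
have Tls w : '[phi, w] = 0 -> 0 <= '[T ls w, w].
  move=> lp_term; apply/ler_addgt0Pr => e e0.
  have w0 := vk_ge0m vk w.
  have e'0 : 0 < e / ('[Lm w, w] + 1) by rewrite divr_gt0// ltr_wpDl.
  have [l [l0 /(_ w lp_term)]] := inf_adherent e'0 S_inf.
  rewrite -/ls !TE => h1 h2.
  have := ler_wpM2r w0 (ltW h2).
  have : e / ('[Lm w, w] + 1) * '[Lm w, w] <= e.
    by rewrite mulrAC ler_pdivrMr ?ltr_wpDl// ler_pM2l// lerDl.
  rewrite mulrDl; lra.
have ls_gt0 : 0 < ls.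
  rewrite lt_def ls0 andbT; apply/eqP => lsE.
  (* s is chosen to make v = phi - s psi orthogonal to phi *)
  pose s := '[phi, phi] / '[psi, phi].
  have [v vE] : exists v, v = phi - s *: psi by exists (phi - s *: psi).
  have sD : s * '[psi, phi] = '[phi, phi] by rewrite /s divfK// gt_eqF.
  have pv : '[phi, v] = 0.
    by rewrite vE dotBr dotZr (dotC H phi psi) sD subrr.
  have [w /annihilator1 lp_term hw] := lax_milgram v sM (vk_coercivem vk).
  have Lmw : Lm w = v.
    apply: (@dot_inj _ _ H) => y.
    have yE : y = (y - ('[phi, y] / '[phi, phi]) *: phi) +
                  ('[phi, y] / '[phi, phi]) *: phi by rewrite subrK.
    rewrite [y in LHS]yE [y in RHS]yE dotDr [RHS]dotDr hw; last first.
      by apply/annihilator1; rewrite dotBr dotZr divfK ?subrr// gt_eqF.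
    rewrite !dotZr sM (vk_phim vk) dot0r (dotC H v phi) pv; ring.
  have := Tls w lp_term; rewrite TE lsE mul0r addr0 Lmw vE.
  rewrite !(symD sP, symZ _ sP, symN sP, dotE) psiE (sP phi psi) psiE.
  rewrite (dotC H phi psi) sD; have := vk_phip vk.
  have : 0 < s * '[phi, phi] by rewrite mulr_gt0// divr_gt0.
  lra.
have [w [lp_term w0 Tw0]] : exists w, [/\ '[phi, w] = 0, w != 0 & '[T ls w, w] = 0].
  apply: contrapT => no.
  have posT v : annihilator H [:: phi] v -> v != 0 -> 0 < '[T ls v, v].
    move=> /annihilator1 pv v0; rewrite lt_def Tls// andbT.
    by apply/eqP => Tv; apply: no; exists v.
  have [gs [cp cp0 hcp]] := vk_tailp vk.
  have [cb cb0 hcb] := coercive_bounded_below (vk_coercivem vk).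
  (* L- w annihilates gs as soon as w annihilates the vectors L- g *)
  have tail : coercive_on H (map Lm gs ++ [:: phi]) (T ls).
    exists (cp * cb) => [|v wv]; first exact: mulr_gt0.
    have pv : annihilator H [:: phi] v.
      by move=> g gg; apply: wv; rewrite mem_cat gg orbT.
    have gv : annihilator H gs (Lm v).
      by move=> g gg; rewrite -sM; apply: wv; rewrite mem_cat map_f.
    rewrite TE; apply: le_trans (le_trans (hcp _ gv) _).
      by rewrite -mulrA ler_pM2l// hcb.
    by rewrite lerDl mulr_ge0// (vk_ge0m vk).
  have [ct ct0 hct] := coercive_on_cat (sT ls) posT tail.
  (* the coercivity of T ls leaves room to lower ls by ct / Cm *)
  pose l := Num.max 0 (ls - ct / Cm).
  have lls : l < ls by rewrite /l gt_max ls_gt0 ltrBlDr ltrDl divr_gt0.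
  have : S l.
    split=> [|v pv]; first by rewrite /l le_max lexx.
    have := hct v; rewrite annihilator1 => /(_ pv).
    have := hCm v; rewrite ger0_norm ?(vk_ge0m vk)// !TE => h1 h2.
    have h3 : ls - l <= ct / Cm by rewrite lerBlDr -lerBlDl /l le_max lexx orbT.
    have h4 := ler_wpM2r (vk_ge0m vk v) h3.
    have h5 : ct / Cm * '[Lm v, v] <= ct * '[v, v].
      by rewrite mulrAC -mulrA ler_pM2l// ler_pdivrMr// mulrC.
    lra.
  by move=> /ls_le; rewrite leNgt lls.
have Tw : T ls w = 0.
  have Tphi : T ls phi = 0.
    by rewrite /T (vk_phim vk) (sym0 sP) (sym0 sM) scaler0 addr0.
  apply: (@dot_self_eq0 _ _ H); apply/eqP; rewrite -sqrf_eq0 eq_le sqr_ge0 andbT.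
  have := @form_schwarz _ _ H [:: phi] _ w (T ls w) (sT ls).
  rewrite Tw0 mul0r; apply.
  - by move=> v /annihilator1; exact: Tls.
  - exact/annihilator1.
  - by apply/annihilator1; rewrite -(sT ls) Tphi dot0l.
pose x := Lp (Lm w) + ls *: w.
have Lx : Lm x = 0 by rewrite /x (symD sM) (symZ _ sM).
pose k := '[phi, x] / '[phi, phi].
have xE : x = k *: phi.
  apply/eqP; rewrite -subr_eq0; apply/eqP/(vk_kerm vk).
    by rewrite dotBr dotZr divfK ?subrr// gt_eqF.
  by rewrite (symD sM) (symN sM) (symZ _ sM) Lx (vk_phim vk) scaler0 subr0.
pose mu := Num.sqrt ls.
have mu0 : 0 < mu by rewrite sqrtr_gt0.
exists mu, (Lm w), (mu^-1 *: (k *: phi - ls *: w)); split=> //.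
- by apply: contra_neq w0 => /(vk_kerm vk lp_term).
- rewrite (symZ _ sM) (symD sM) (symN sM) !(symZ _ sM) (vk_phim vk).
  rewrite scaler0 sub0r scalerN opprK scalerA.
  by rewrite -[ls](sqr_sqrtr ls0) expr2 mulKf// gt_eqF.
- rewrite scalerA divff ?gt_eqF// scale1r -xE.
  by rewrite /x addrK.
Qed.

End VK.
End Symmetric.

(** * Unordered sums of real families *)

Section Sums.
Variables (R : realType) (I : choiceType).
Implicit Types (f g p q : I -> R) (s : seq I).

Definition nsum p : \bar R := \esum_(i in [set: I]) (p i)%:E.

Lemma nsum_ge0 p : (forall i, 0 <= p i) -> (0 <= nsum p)%E.
Proof. by move=> p0; apply: esum_ge0 => i _; rewrite lee_fin. Qed.

Lemma le_nsum p q : (forall i, p i <= q i) -> (nsum p <= nsum q)%E.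
Proof. by move=> pq; apply: le_esum => i _; rewrite lee_fin. Qed.

Lemma nsum_le p (M : \bar R) : (forall s, uniq s -> ((\sum_(i <- s) p i)%:E <= M)%E) ->
  (nsum p <= M)%E.
Proof.
move=> h; apply: ge_ereal_sup => _ [A [finA _] <-].
by rewrite fsbig_finite// sumEFin; exact: h.
Qed.

Lemma seq_le_nsum p s : (forall i, 0 <= p i) -> uniq s ->
  ((\sum_(i <- s) p i)%:E <= nsum p)%E.
Proof.
move=> p0 us; apply: esum_ge; exists [set` s]; first by split.
rewrite fsbig_finite//= sumEFin lee_fin le_eqVlt; apply/orP; left.
apply/eqP/perm_big/uniq_perm => [//||x]; first exact: finmap.fset_uniq.
by rewrite in_fset_set ?mem_setE.
Qed.

Lemma nsumZ (a : R) p : 0 <= a -> (forall i, 0 <= p i) ->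
  (nsum (fun i => (a * p i)%R) = a%:E * nsum p)%E.
Proof.
have le (b : R) q : 0 <= b -> (forall i, 0 <= q i) ->
    (nsum (fun i => (b * q i)%R) <= b%:E * nsum q)%E.
  move=> b0 q0; apply: nsum_le => s us.
  by rewrite -mulr_sumr EFinM lee_wpmul2l ?lee_fin// seq_le_nsum.
move=> a0 p0; apply/eqP; rewrite eq_le le//=.
have [->|an0] := eqVneq a 0.
  by rewrite mul0e nsum_ge0// => i; rewrite mul0r.
have a1 : 0 <= a^-1 by rewrite invr_ge0.
have := le _ (fun i => a * p i) a1 (fun i => mulr_ge0 a0 (p0 i)).
under [X in (nsum X <= _)%E]eq_fun do rewrite mulKf//.
move=> /(lee_wpmul2l (x := a%:E)).
by rewrite lee_fin muleA -EFinM divff// mul1e; apply.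
Qed.

Lemma nsumD p q : (forall i, 0 <= p i) -> (forall i, 0 <= q i) ->
  (nsum (fun i => p i + q i)%R = nsum p + nsum q)%E.
Proof. by move=> p0 q0; rewrite -esumD// => i _; rewrite lee_fin. Qed.

Definition abs_summable f := (nsum (fun i => `|f i|%R) < +oo)%E.

Lemma abs_summable_le f g :
  (forall i, `|f i| <= `|g i|) -> abs_summable g -> abs_summable f.
Proof. by move=> fg; apply: le_lt_trans; exact: le_nsum. Qed.

Lemma abs_summableD f g :
  abs_summable f -> abs_summable g -> abs_summable (fun i => f i + g i).
Proof.
move=> sf sg; apply: (@le_lt_trans _ _ (nsum (fun i => `|f i| + `|g i|))).
  by apply: le_nsum => i; exact: ler_normD.
by rewrite nsumD// lte_add_pinfty.
Qed.

Lemma abs_summableZ a f : abs_summable f -> abs_summable (fun i => a * f i).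
Proof.
move=> sf; rewrite /abs_summable; under eq_fun do rewrite normrM.
by rewrite nsumZ// lte_mul_pinfty// lee_fin.
Qed.

Lemma nsum_fin p : (forall i, 0 <= p i) -> abs_summable p ->
  nsum p \is a fin_num.
Proof.
move=> p0 sp; rewrite ge0_fin_numE ?nsum_ge0//.
by congr (_ < _)%E: sp; congr nsum; apply/funext => i; rewrite ger0_norm.
Qed.

(** The two families that are subtracted are nonnegative, which reduces the
    linearity of the signed sum to the additivity of [nsum]. *)
Definition isum f : R :=
  fine (nsum (fun i => `|f i| + f i)) - fine (nsum (fun i => `|f i|)).

Lemma norm_add_ge0 (x : R) : 0 <= `|x| + x.
Proof. by have := ler_norm (- x); rewrite normrN; lra. Qed.

Lemma abs_summable_norm f : abs_summable f -> abs_summable (fun i => `|f i|).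
Proof. by apply: abs_summable_le => i; rewrite normr_id. Qed.

Lemma abs_summable_pos f : abs_summable f -> abs_summable (fun i => `|f i| + f i).
Proof. by move=> sf; apply: abs_summableD => //; exact: abs_summable_norm. Qed.

(** The sum does not depend on how the family is split as a difference. *)
Lemma isumB p q : (forall i, 0 <= p i) -> (forall i, 0 <= q i) ->
  abs_summable p -> abs_summable q ->
  isum (fun i => p i - q i) = fine (nsum p) - fine (nsum q).
Proof.
move=> p0 q0 sp sq; rewrite /isum; set f := fun i => p i - q i.
have sf : abs_summable f.
  apply: abs_summableD => //; apply: abs_summable_le sq => i.
  by rewrite normrN.
apply/eqP; rewrite subr_eq addrAC eq_sym subr_eq -!fineD; last 4 first.
- by apply: nsum_fin => [i|]; [exact: norm_add_ge0|exact: abs_summable_pos].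
- exact: nsum_fin.
- exact: nsum_fin.
- by apply: nsum_fin => //; exact: abs_summable_norm.
rewrite -!nsumD// => [|i]; last exact: norm_add_ge0.
apply/eqP; congr (fine (nsum _)); apply/funext => i; rewrite /f; ring.
Qed.

Lemma isum_nneg p : (forall i, 0 <= p i) -> abs_summable p -> isum p = fine (nsum p).
Proof.
move=> p0 sp.
have s0 : abs_summable (fun _ : I => 0).
  by apply: abs_summable_le sp => i; rewrite normr0.
have := isumB p0 (fun=> lexx 0) sp s0.
rewrite [nsum (fun=> 0)]esum1// subr0 => <-.
by congr isum; apply/funext => i; rewrite subr0.
Qed.

Lemma isumD f g : abs_summable f -> abs_summable g ->
  isum (fun i => f i + g i) = isum f + isum g.
Proof.
move=> sf sg.
have -> : isum (fun i => f i + g i) =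
    isum (fun i => (`|f i| + f i) + (`|g i| + g i) - (`|f i| + `|g i|)).
  by congr isum; apply/funext => i; ring.
have sfp := abs_summable_pos sf; have sgp := abs_summable_pos sg.
have sfn := abs_summable_norm sf; have sgn := abs_summable_norm sg.
rewrite isumB; last 4 first.
- by move=> i; rewrite addr_ge0 ?norm_add_ge0.
- by move=> i; rewrite addr_ge0.
- exact: abs_summableD.
- exact: abs_summableD.
have fp := fun i => norm_add_ge0 (f i); have gp := fun i => norm_add_ge0 (g i).
rewrite [X in fine X - _](nsumD fp gp) [X in _ - fine X]nsumD//.
rewrite !fineD ?nsum_fin// /isum; ring.
Qed.

Lemma isumZ a f : abs_summable f -> isum (fun i => a * f i) = a * isum f.
Proof.
move=> sf; have sfp := abs_summable_pos sf; have sfn := abs_summable_norm sf.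
have fp := fun i => norm_add_ge0 (f i).
wlog a0 : a / 0 <= a => [hw|].
  have [/hw//|a0] := leP 0 a.
  have := hw (- a); rewrite oppr_ge0 => /(_ (ltW a0)) h.
  have s1 := abs_summableZ a sf; have s2 := abs_summableZ (- a) sf.
  have := isumD s1 s2.
  have -> : (fun i => a * f i + - a * f i) = (fun _ : I => 0).
    by apply/funext => i; ring.
  rewrite h [isum (fun=> 0)]isum_nneg//; last first.
    by apply: abs_summable_le sf => i; rewrite normr0.
  by rewrite [nsum _]esum1//= => /eqP; rewrite mulNr eq_sym subr_eq0 => /eqP.
have -> : isum (fun i => a * f i) =
    isum (fun i => a * (`|f i| + f i) - a * `|f i|).
  by congr isum; apply/funext => i; ring.
rewrite isumB; last 4 first.
- by move=> i; rewrite mulr_ge0.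
- by move=> i; rewrite mulr_ge0.
- exact: abs_summableZ.
- exact: abs_summableZ.
by rewrite !nsumZ// !fineM ?nsum_fin// /isum mulrBr.
Qed.

(** For a family that is not summable both sums are infinite, and the value is
    0 by convention. *)
Lemma isum_ge0 f : (forall i, 0 <= f i) -> 0 <= isum f.
Proof.
move=> f0; have [sf|nf] := pselect (abs_summable f).
  by rewrite isum_nneg// fine_ge0// nsum_ge0.
have e : nsum (fun i => `|f i|) = +oo%E.
  apply/eqP; rewrite -leye_eq leNgt; exact/negP.
have -> : isum f = 0.
  rewrite /isum e (_ : nsum _ = +oo%E) ?subrr//.
  apply/eqP; rewrite -leye_eq -e; apply: le_nsum => i.
  by rewrite lerDl.
by [].
Qed.

Lemma le_isum f g : abs_summable f -> abs_summable g ->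
  (forall i, f i <= g i) -> isum f <= isum g.
Proof.
move=> sf sg fg; rewrite -subr_ge0.
have -> : isum g - isum f = isum (fun i => g i + (- 1) * f i).
  by rewrite isumD ?isumZ ?mulN1r//; exact: abs_summableZ.
by apply: isum_ge0 => i; rewrite mulN1r subr_ge0.
Qed.

Lemma seq_le_isum p s : (forall i, 0 <= p i) -> abs_summable p -> uniq s ->
  \sum_(i <- s) p i <= isum p.
Proof.
move=> p0 sp us; rewrite isum_nneg// -lee_fin fineK ?nsum_fin//.
exact: seq_le_nsum.
Qed.

Lemma summable_bound p (M : R) : (forall i, 0 <= p i) ->
  (forall s, uniq s -> \sum_(i <- s) p i <= M) ->
  abs_summable p /\ isum p <= M.
Proof.
move=> p0 h; have nM : (nsum p <= M%:E)%E.
  by apply: nsum_le => s us; rewrite lee_fin h.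
have sp : abs_summable p.
  rewrite /abs_summable (_ : (fun i => `|p i|) = p).
    by rewrite (le_lt_trans nM) ?ltry.
  by apply/funext => i; rewrite ger0_norm.
by split=> //; rewrite isum_nneg// -lee_fin fineK ?nsum_fin.
Qed.

Lemma nsum_reindex (e : I -> I) p : bijective e ->
  nsum (p \o e) = nsum p.
Proof.
move=> be; rewrite /nsum [RHS](@reindex_esum _ _ _ [set: I] _ e)//.
split=> //; first by move=> x y _ _; exact: bij_inj.
by move=> y _; case: be => g _ ge; exists (g y).
Qed.

Lemma isum_reindex (e : I -> I) f : bijective e -> isum (f \o e) = isum f.
Proof.
move=> be; rewrite /isum.
by rewrite -(nsum_reindex (fun i => `|f i| + f i) be) -(nsum_reindex (fun i => `|f i|) be).
Qed.

Lemma abs_summable_reindex (e : I -> I) f : bijective e ->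
  abs_summable f -> abs_summable (f \o e).
Proof. by move=> be; rewrite /abs_summable -(nsum_reindex _ be). Qed.

End Sums.

(** * The Hilbert space of square summable families *)

Section SquareSummable.
Variables (R : realType) (I : choiceType).

Definition square_summable : {pred I -> R^o} :=
  fun f => `[< abs_summable (fun i => f i ^+ 2) >].

Record l2 := L2 { l2_fun :> I -> R^o; l2_subproof : l2_fun \in square_summable }.

HB.instance Definition _ := [isSub for l2_fun].
HB.instance Definition _ := [Choice of l2 by <:].

Lemma square_summableP f :
  reflect (abs_summable (fun i => f i ^+ 2)) (f \in square_summable).
Proof. exact: asboolP. Qed.

Lemma l2P (f : l2) : abs_summable (fun i => f i ^+ 2).
Proof. exact/square_summableP/l2_subproof. Qed.

Lemma abs_summableM (f g : I -> R) : abs_summable (fun i => f i ^+ 2) ->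
  abs_summable (fun i => g i ^+ 2) -> abs_summable (fun i => f i * g i).
Proof.
move=> sf sg; apply: abs_summable_le (abs_summableD sf sg) => i.
rewrite normrM [leRHS]ger0_norm ?addr_ge0 ?sqr_ge0// -(real_normK (num_real (f i))).
rewrite -(real_normK (num_real (g i))).
have := sqr_ge0 (`|f i| - `|g i|); rewrite sqrrB.
have := mulr_ge0 (normr_ge0 (f i)) (normr_ge0 (g i)); lra.
Qed.

Lemma square_summable_closed : submod_closed square_summable.
Proof.
split=> [|a f g].
  apply/square_summableP; rewrite /abs_summable [nsum _]esum1 ?ltry//=.
  by move=> i _; rewrite expr0n/= normr0.
move=> /square_summableP sf /square_summableP sg; apply/square_summableP.
have := abs_summableD (abs_summableD (abs_summableZ (a ^+ 2) sf)
  (abs_summableZ (2 * a) (abs_summableM sf sg))) sg.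
apply: abs_summable_le => i.
rewrite le_eqVlt; apply/orP; left; apply/eqP; congr `|_|.
rewrite (_ : (_ + _) i = a * (f i : R) + (g i : R))//.
move: (f i : R) (g i : R) => x y; ring.
Qed.

HB.instance Definition _ := GRing.isSubmodClosed.Build R (I -> R^o) square_summable
  square_summable_closed.

HB.instance Definition _ := [SubChoice_isSubLmodule of l2 by <:].

Implicit Types (f g h : l2).

Lemma l2_inj f g : f =1 g -> f = g.
Proof. by move=> fg; apply/val_inj/funext. Qed.

Lemma l2D f g i : (f + g) i = f i + g i.
Proof. by []. Qed.
Lemma l2Z a f i : (a *: f) i = a * f i.
Proof. by []. Qed.
Lemma l2N f i : (- f) i = - f i.
Proof. by []. Qed.
Lemma l20 i : (0 : l2) i = 0.
Proof. by []. Qed.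

Definition l2dot f g : R := isum (fun i => f i * g i).

Lemma l2_summable f g : abs_summable (fun i => f i * g i).
Proof. by apply: abs_summableM; exact: l2P. Qed.

Lemma l2_coord f i : f i ^+ 2 <= l2dot f f.
Proof.
have := @seq_le_isum _ _ (fun i => f i * f i) [:: i] _ (l2_summable f f) isT.
rewrite big_seq1 expr2; apply => j; rewrite -expr2; exact: sqr_ge0.
Qed.

Lemma real_cauchy_cvg (a_ : nat -> R) :
  (forall e : R, 0 < e -> exists N, forall m n, (N <= m)%N -> (N <= n)%N ->
     `|a_ m - a_ n| < e) -> exists l : R, a_ @ \oo --> l.
Proof.
move=> h; suff /cvg_ex[l] : cvg (a_ @ \oo) by exists l.
apply: cauchy_cvg; apply: cauchy_exP => e e0.
have [N HN] := h e e0; exists (a_ N); exists N => // n Nn.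
by rewrite /= /ball/=; exact: HN.
Qed.

(** The limit is taken coordinatewise; bounding finite partial sums first gives
    the convergence in norm and the square summability of the limit. *)
Lemma l2_complete (x_ : nat -> l2) :
  (forall e : R, 0 < e -> exists N, forall m n, (N <= m)%N -> (N <= n)%N ->
     l2dot (x_ m - x_ n) (x_ m - x_ n) < e) ->
  exists l, forall e : R, 0 < e -> exists N, forall n, (N <= n)%N ->
    l2dot (x_ n - l) (x_ n - l) < e.
Proof.
move=> xC.
have /choice[l l_lim] i : exists l : R, (fun n => x_ n i : R) @ \oo --> l.
  apply: real_cauchy_cvg => e e0.
  have [|N HN] := xC (e ^+ 2); first by rewrite exprn_gt0.
  exists N => m n Nm Nn; rewrite -(ltr_pXn2r (n := 2))// ?nnegrE ?ltW//.
  rewrite real_normK ?num_real// -l2N -l2D.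
  exact: le_lt_trans (l2_coord _ _) (HN m n Nm Nn).
have lim_le e N : (forall m n, (N <= m)%N -> (N <= n)%N ->
    l2dot (x_ m - x_ n) (x_ m - x_ n) < e) -> forall n, (N <= n)%N ->
    abs_summable (fun i => (x_ n i - l i) ^+ 2) /\
    isum (fun i => (x_ n i - l i) ^+ 2) <= e.
  move=> HN n Nn; apply: summable_bound => [i|s us]; first exact: sqr_ge0.
  have cs : (fun m => \sum_(i <- s) (x_ n i - x_ m i : R) ^+ 2) @ \oo
      --> \sum_(i <- s) (x_ n i - l i) ^+ 2.
    apply: cvg_big => [|i _]; first exact: add_continuous.
    rewrite expr2; under eq_fun do rewrite expr2.
    by apply: cvgM; apply: cvgB; [exact: cvg_cst|exact: l_lim|
      exact: cvg_cst|exact: l_lim].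
  rewrite -(cvg_lim _ cs)//; apply: limr_le; first by apply/cvg_ex; eexists; exact: cs.
  exists N => // m Nm /=; apply: le_trans (ltW (HN n m Nn Nm)).
  apply: (@seq_le_isum _ _ (fun i => (x_ n - x_ m) i * (x_ n - x_ m) i)) => //.
    by move=> i; rewrite -expr2 sqr_ge0.
  exact: l2_summable.
have ll : (l : I -> R^o) \in square_summable.
  have [N HN] := xC 1 ltr01; have [sN _] := lim_le _ _ HN N (leqnn N).
  have -> : l = (x_ N : I -> R^o) - (fun i => x_ N i - l i : R^o).
    by apply/funext => i; symmetry; exact: (subKr (x_ N i : R) (l i)).
  by rewrite rpredB//; [exact: l2_subproof|exact/square_summableP].
exists (L2 ll) => e e0.
have e20 : 0 < e / 2 by rewrite divr_gt0.
have [N HN] := xC _ e20; exists N => n Nn.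
have [_ h] := lim_le _ _ HN n Nn.
by apply: (@le_lt_trans _ _ (e / 2)) => //; rewrite ltr_pdivrMr// ltr_pMr// ltr1n.
Qed.

Lemma l2dotC f g : l2dot f g = l2dot g f.
Proof. by congr isum; apply/funext => i; rewrite mulrC. Qed.

Lemma l2dotDl f g h : l2dot (f + g) h = l2dot f h + l2dot g h.
Proof.
rewrite -isumD; try exact: l2_summable.
by congr isum; apply/funext => i; rewrite l2D mulrDl.
Qed.

Lemma l2dotZl a f g : l2dot (a *: f) g = a * l2dot f g.
Proof.
rewrite -isumZ; last exact: l2_summable.
by congr isum; apply/funext => i; rewrite l2Z mulrA.
Qed.

Lemma l2dot_gt0 f : f != 0 -> 0 < l2dot f f.
Proof.
move=> f0; have [i fi] : exists i, f i != 0.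
  apply: contrapT => h; move/eqP: f0; apply; apply: l2_inj => i.
  by apply/eqP; apply: contrapT => /negP fi; apply: h; exists i.
by apply: lt_le_trans (l2_coord f i); rewrite exprn_even_gt0.
Qed.

Definition l2_hilbert : hilbert l2 :=
  Hilbert l2dotC l2dotDl l2dotZl l2dot_gt0 l2_complete.

End SquareSummable.

(** * Coordinates, multiplication and shift operators *)

Section Coordinates.
Variables (R : realType) (I : choiceType).
Local Notation l2 := (l2 R I).
Local Notation "''[' x , y ]" := (dot (l2_hilbert R I) x y).
Implicit Types (v w : l2) (m : I -> R).

(** The value is 0 on families that are not square summable. *)
Definition mkl2 (f : I -> R) : l2 := insubd (0 : l2) (f : I -> R^o).

Lemma mkl2E (f : I -> R) :
  abs_summable (fun i => f i ^+ 2) -> forall i, mkl2 f i = f i.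
Proof.
by move=> sf i; rewrite [_ i](congr1 (@^~ i) (insubdK _ _))//; exact/square_summableP.
Qed.

Lemma l2_dotE v w : '[v, w] = isum (fun i => v i * w i).
Proof. by []. Qed.

Lemma isum_point (f : I -> R) n : (forall i, i != n -> f i = 0) -> isum f = f n.
Proof.
have h (p : I -> R) : (forall i, 0 <= p i) -> (forall i, i != n -> p i = 0) ->
    nsum p = (p n)%:E.
  move=> p0 pn; apply/eqP; rewrite eq_le; apply/andP; split.
    apply: nsum_le => s us; rewrite lee_fin.
    have [ns|ns] := boolP (n \in s).
      by rewrite (bigD1_seq n)//= big1 ?addr0// => i /pn.
    rewrite big_seq big1// => i si; apply: pn.
    by apply: contraNneq ns => <-.
  by have := @seq_le_nsum _ _ p [:: n] p0 isT; rewrite big_seq1.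
move=> fn; rewrite /isum !h//=.
- by rewrite addrAC subrr add0r.
- by move=> i /fn ->; rewrite normr0.
- by move=> i; exact: norm_add_ge0.
- by move=> i /fn ->; rewrite normr0 addr0.
Qed.

Definition site n : l2 := mkl2 (fun i => (i == n)%:R).

Lemma siteE n i : site n i = (i == n)%:R.
Proof.
rewrite mkl2E//; have [||//] := @summable_bound R I (fun i => (i == n)%:R ^+ 2) 1.
  by move=> j; exact: sqr_ge0.
move=> s us; have [ns|ns] := boolP (n \in s).
  by rewrite (bigD1_seq n)//= big1 ?addr0 ?eqxx ?expr1n// => j /negPf->; rewrite expr0n.
rewrite big_seq big1// => j js; rewrite (_ : j == n = false) ?expr0n//.
by apply: contraNF ns => /eqP <-.
Qed.

Lemma dot_site n v : '[site n, v] = v n.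
Proof.
rewrite l2_dotE (@isum_point _ n) => [|i /negPf ni].
  by rewrite siteE eqxx mul1r.
by rewrite siteE ni mul0r.
Qed.

(** Otherwise arbitrarily many coordinates would be at least c in absolute
    value, and their squares would add up beyond <v, v>. *)
Lemma l2_tail v (c : R) : 0 < c -> exists s : seq I, forall n, n \notin s -> `|v n| < c.
Proof.
move=> c0; apply: contrapT => no.
have long k : exists2 s : seq I, uniq s & c ^+ 2 * k%:R <= \sum_(i <- s) v i * v i.
  elim: k => [|k [s us hs]]; first by exists [::]; rewrite ?big_nil ?mulr0.
  have [n [ns cn]] : exists n, n \notin s /\ c <= `|v n|.
    apply: contrapT => h; apply: no; exists s => n ns; rewrite ltNge.
    by apply/negP => cn; apply: h; exists n.
  exists (n :: s); first by rewrite /= ns us.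
  rewrite big_cons -natr1 mulrDr mulr1 addrC lerD// -expr2.
  by rewrite -[leRHS]real_normK ?num_real// lerXn2r ?nnegrE// ltW.
have [k hk] : exists k : nat, '[v, v] < c ^+ 2 * k%:R.
  exists (Num.truncn ('[v, v] / c ^+ 2)).+1.
  by rewrite mulrC -ltr_pdivrMr ?exprn_gt0//; exact: truncnS_gt.
have [s us hs] := long k.
have := @seq_le_isum _ _ (fun i => v i * v i) s _ (l2_summable v v) us.
have v2 i : 0 <= v i * v i :> R by rewrite -expr2 sqr_ge0.
by move=> /(_ v2)/(le_trans hs); rewrite leNgt hk.
Qed.

Definition mul_op m v : l2 := mkl2 (fun i => m i * v i).

Definition shift_op (e : I -> I) v : l2 := mkl2 (fun i => v (e i)).

Definition bounded_values m := exists M : R, forall i, `|m i| <= M.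

Lemma mul_opE m v i : bounded_values m -> mul_op m v i = m i * v i.
Proof.
move=> [M mM]; rewrite mkl2E//.
apply: abs_summable_le (abs_summableZ (M ^+ 2) (l2P v)) => j.
rewrite exprMn (normrM (m j ^+ 2)) (normrM (M ^+ 2)) ler_wpM2r// [leRHS]ger0_norm ?sqr_ge0//.
rewrite ger0_norm ?sqr_ge0//.
rewrite -[leLHS]real_normK ?num_real// lerXn2r ?nnegrE//.
by rewrite (le_trans _ (mM j)).
Qed.

Lemma shift_opE e v i : bijective e -> shift_op e v i = v (e i).
Proof.
move=> be; rewrite mkl2E//.
exact: (@abs_summable_reindex _ _ e (fun i => v i ^+ 2) be (l2P v)).
Qed.

Lemma mul_op_sym m : bounded_values m -> symmetric_op (l2_hilbert R I) (mul_op m).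
Proof.
move=> bm v w; rewrite !l2_dotE; congr isum; apply/funext => i.
by rewrite !mul_opE// mulrCA mulrA.
Qed.

Lemma mul_op_bounded m : bounded_values m -> bounded_op (l2_hilbert R I) (mul_op m).
Proof.
move=> bm; have [M mM] := bm; exists (M ^+ 2) => v.
rewrite !l2_dotE -isumZ; last exact: l2_summable.
apply: le_isum; [exact: l2_summable|exact/abs_summableZ/l2_summable|move=> i].
rewrite mul_opE// -!expr2 exprMn ler_wpM2r ?sqr_ge0//.
rewrite -[leLHS]real_normK ?num_real// lerXn2r ?nnegrE//.
by rewrite (le_trans _ (mM i)).
Qed.

Lemma shift_op_adjoint (e e' : I -> I) v w : cancel e e' -> cancel e' e ->
  '[shift_op e v, w] = '[v, shift_op e' w].
Proof.
move=> ee' e'e; have be : bijective e by exists e'.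
have be' : bijective e' by exists e.
rewrite !l2_dotE -[RHS](isum_reindex _ be); congr isum; apply/funext => i.
by rewrite /= !shift_opE// ee'.
Qed.

Lemma shift_op_norm e v : bijective e -> '[shift_op e v, shift_op e v] = '[v, v].
Proof.
move=> be; rewrite !l2_dotE -[RHS](isum_reindex _ be); congr isum.
by apply/funext => i; rewrite /= !shift_opE.
Qed.

End Coordinates.

(** * Schroedinger operators on the lattice *)

Section Schroedinger.
Variables (R : realType) (d : nat).
Local Notation l2 := (l2 R (lattice d)).
Local Notation H := (l2_hilbert R (lattice d)).
Local Notation "''[' x , y ]" := (dot H x y).
Implicit Types (v w : l2) (m : lattice d -> R) (c : R).

(** The 2d directions are indexed by a coordinate and a sign. *)
Definition step (k : 'I_d * bool) (n : lattice d) : lattice d :=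
  n + (-1) ^+ k.2 *: delta_mx 0 k.1.

Definition flip (k : 'I_d * bool) := (k.1, ~~ k.2).

Lemma flipK : involutive flip.
Proof. by case=> i b; rewrite /flip/= negbK. Qed.

Lemma stepK k : cancel (step k) (step (flip k)).
Proof.
by case: k => i b n; rewrite /step/= signrN scaleNr addrK.
Qed.

Lemma flip_stepK k : cancel (step (flip k)) (step k).
Proof. by rewrite -{2}[k]flipK; exact: stepK. Qed.

Lemma step_bij k : bijective (step k).
Proof. by exists (step (flip k)); [exact: stepK|exact: flip_stepK]. Qed.

Definition adjacency v : l2 := \sum_k shift_op (step k) v.

Lemma l2_sum (J : Type) (r : seq J) (P : pred J) (F : J -> l2) n :
  (\sum_(k <- r | P k) F k) n = \sum_(k <- r | P k) F k n.
Proof. by elim/big_ind2 : _ => // _ x _ y <- <-; rewrite l2D. Qed.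

Lemma dot_suml (J : Type) (r : seq J) (F : J -> l2) v :
  '[\sum_(k <- r) F k, v] = \sum_(k <- r) '[F k, v].
Proof.
by elim/big_rec2 : _ => [|k x y _ <-]; rewrite ?dotE.
Qed.

Lemma adjacencyE v n : adjacency v n = \sum_k v (step k n).
Proof.
by rewrite l2_sum; apply: eq_bigr => k _; rewrite shift_opE//; exact: step_bij.
Qed.

Lemma adjacency_sym : symmetric_op H adjacency.
Proof.
move=> v w; rewrite (dotC _ v) !dot_suml.
rewrite (reindex_inj (inv_inj flipK)); apply: eq_bigr => k _.
by rewrite (shift_op_adjoint _ _ (flip_stepK k) (stepK k)) dotC.
Qed.

Lemma card_steps : #|{: 'I_d * bool}| = (2 * d)%N.
Proof. by rewrite card_prod card_ord card_bool mulnC. Qed.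

(** The operator is a sum of 2d isometries. *)
Lemma adjacency_le v : '[adjacency v, v] <= (2 * d)%:R * '[v, v].
Proof.
rewrite dot_suml mulr_natl -card_steps -sumr_const; apply: ler_sum => k _.
have := dot_ge0 H (shift_op (step k) v - v).
rewrite !dotE shift_op_norm; last exact: step_bij.
rewrite (dotC H v); lra.
Qed.

Lemma bounded_opD (T1 T2 : l2 -> l2) : bounded_op H T1 -> bounded_op H T2 ->
  bounded_op H (fun v => T1 v + T2 v).
Proof.
move=> [K1 h1] [K2 h2]; exists (2 * K1 + 2 * K2) => v.
have := h1 v; have := h2 v; have := dot_ge0 H (T1 v - T2 v).
rewrite !dotE (dotC H (T2 v)); lra.
Qed.

Lemma bounded_op_scale c : bounded_op H (fun v => c *: v).
Proof. by exists (c ^+ 2) => v; rewrite !dotE mulrA expr2. Qed.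

Lemma bounded_opZ c T : bounded_op H T -> bounded_op H (fun v => c *: T v).
Proof.
move=> [K h]; exists (c ^+ 2 * K) => v; rewrite !dotE mulrA -expr2 -mulrA.
by rewrite ler_wpM2l ?sqr_ge0.
Qed.

Lemma adjacency_bounded : bounded_op H adjacency.
Proof.
rewrite /adjacency; elim: (index_enum _) => [|k r [K h]].
  by exists 0 => v; rewrite big_nil dotE mul0r.
have [|K' h'] := @bounded_opD (shift_op (step k)) (fun v => \sum_(j <- r) shift_op (step j) v) _ (ex_intro _ K h).
  by exists 1 => v; rewrite mul1r shift_op_norm//; exact: step_bij.
by exists K' => v; rewrite big_cons.
Qed.

(** The diagonal part c contains the diagonal of the discrete Laplacian: L+ and
    L- have c = 2d + omega. *)
Definition schr c m v : l2 := c *: v - adjacency v - mul_op m v.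

Lemma schrE c m v n : bounded_values m ->
  schr c m v n = c * v n - \sum_k v (step k n) - m n * v n.
Proof. by move=> bm; rewrite /schr !(l2D, l2N, l2Z) adjacencyE mul_opE. Qed.

Lemma schr_form c m v w :
  '[schr c m v, w] = c * '[v, w] - '[adjacency v, w] - '[mul_op m v, w].
Proof. by rewrite /schr !dotE. Qed.

Lemma schr_sym c m : bounded_values m -> symmetric_op H (schr c m).
Proof.
by move=> bm v w; rewrite /schr !dotE adjacency_sym mul_op_sym.
Qed.

Lemma schr_bounded c m : bounded_values m -> bounded_op H (schr c m).
Proof.
move=> bm.
have := bounded_opD (bounded_opD (bounded_op_scale c) (bounded_opZ (- 1) adjacency_bounded))
  (bounded_opZ (- 1) (mul_op_bounded bm)).
by move=> [K h]; exists K => v; have := h v; rewrite !scaleN1r.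
Qed.

(** On families that vanish on s, the potential is at most w0 / 2, and
    what remains is at least the form of -Delta + w0 / 2. *)
Lemma schr_tail (w0 : R) m (s : seq (lattice d)) : bounded_values m -> 0 < w0 ->
  (forall n, n \notin s -> m n <= w0 / 2) ->
  coercive_on H (map (@site R _) s) (schr ((2 * d)%:R + w0) m).
Proof.
move=> bm w00 ms; exists (w0 / 2) => [|v vs]; first by rewrite divr_gt0.
have vs0 n : n \in s -> v n = 0.
  by move=> ns; rewrite -dot_site; apply: vs; exact: map_f.
have : '[mul_op m v, v] <= w0 / 2 * '[v, v].
  rewrite !l2_dotE -isumZ; last exact: l2_summable.
  apply: le_isum; [exact: l2_summable|exact/abs_summableZ/l2_summable|move=> n].
  rewrite mul_opE// -[leLHS]mulrA; have [/vs0->|/ms h] := boolP (n \in s).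
    by rewrite !mulr0.
  by apply: ler_wpM2r => //; rewrite -expr2 sqr_ge0.
have := adjacency_le v; rewrite schr_form mulrDl; lra.
Qed.

Definition abs_l2 v : l2 := mkl2 (fun i => `|v i|).

Lemma abs_l2E v n : abs_l2 v n = `|v n| :> R.
Proof.
rewrite mkl2E//; apply: abs_summable_le (l2P v) => i.
by rewrite real_normK ?num_real.
Qed.

(** Only the hopping term changes under v |-> |v|, and it can only grow. *)
Lemma abs_l2_form c m v : bounded_values m ->
  '[schr c m (abs_l2 v), abs_l2 v] <= '[schr c m v, v].
Proof.
move=> bm; rewrite !schr_form.
have -> : '[abs_l2 v, abs_l2 v] = '[v, v].
  rewrite !l2_dotE; congr isum; apply/funext => i.
  by rewrite !abs_l2E -!expr2 real_normK ?num_real.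
have -> : '[mul_op m (abs_l2 v), abs_l2 v] = '[mul_op m v, v].
  rewrite !l2_dotE; congr isum; apply/funext => i.
  rewrite (mul_opE _ _ bm) (mul_opE v _ bm) abs_l2E -[LHS]mulrA -[RHS]mulrA.
  by rewrite -!expr2 real_normK ?num_real.
suff : '[adjacency v, v] <= '[adjacency (abs_l2 v), abs_l2 v] by lra.
rewrite !l2_dotE; apply: le_isum; try exact: l2_summable.
move=> i; rewrite !adjacencyE abs_l2E (le_trans (ler_norm _))// normrM ler_wpM2r//.
rewrite (le_trans (ler_norm_sum _ _ _))//; apply: ler_sum => k _.
by rewrite abs_l2E.
Qed.

(** At a zero of v the equation says that the sum of v over the neighbours
    vanishes, so that v vanishes at each of them, and the lattice is
    connected. *)
Lemma schr_max_principle c m v n : bounded_values m ->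
  (forall j, 0 <= v j :> R) -> schr c m v = 0 -> v n = 0 -> v = 0.
Proof.
move=> bm v0 Lv vn.
have nb j k : v j = 0 -> v (step k j) = 0.
  move=> vj; have := schrE c v j bm; rewrite Lv vj l20 !mulr0 subr0 sub0r.
  move=> /esym/eqP; rewrite oppr_eq0 psumr_eq0 => [/allP/(_ k)|i _]; last exact: v0.
  by rewrite mem_index_enum => /(_ isT)/eqP.
(* zeros propagate along each coordinate axis *)
have line j (i : 'I_d) (z : int) : v j = 0 -> v (j + z *: delta_mx 0 i) = 0.
  elim/int_ind : z j => [j|z IH j|z IH j] vj; first by rewrite scale0r addr0.
    rewrite intS scalerDl addrA scale1r; apply: IH.
    by have := nb j (i, false) vj; rewrite /step/= expr0 scale1r.
  rewrite intS opprD scalerDl addrA; apply: IH.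
  by have := nb j (i, true) vj; rewrite /step/= expr1.
apply: l2_inj => j; rewrite l20.
suff all (r : seq 'I_d) : v (n + \sum_(i <- r) (j - n) ord0 i *: delta_mx 0 i) = 0.
  have := all (index_enum _); rewrite -row_sum_delta.
  by rewrite addrC subrK.
elim: r => [|i r IH]; first by rewrite big_nil addr0.
by rewrite big_cons addrCA addrC; exact: line.
Qed.

End Schroedinger.

(** * The energy and the linearized operators as operators on real families *)

Section Neighbours.
Variable d : nat.

(** A sum of squares of integers is 1 only if one of them is 1 or -1 and the
    others are 0. *)
Lemma neighboursP (j n : lattice d) :
  neighbours j n <-> exists k, j = step k n.
Proof.
rewrite /neighbours; split=> [h|[k ->]]; last first.
  rewrite (bigD1 k.1)//= big1 => [|i ik].
    by rewrite addr0 /step !mxE !eqxx mulr1 addrAC subrr add0r sqrr_sign.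
  by rewrite /step !mxE eqxx (negPf ik) mulr0 addr0 subrr expr0n.
pose z i := j ord0 i - n ord0 i.
have [i zi] : exists i, z i != 0.
  apply: contrapT => no; have : \sum_(i < d) z i ^+ 2 = 0.
    rewrite big1// => i _; have [->|zi] := eqVneq (z i) 0; first by rewrite expr0n.
    by exfalso; apply: no; exists i.
  by rewrite [LHS]h.
have zi1 : 1 <= z i ^+ 2 by rewrite -gtz0_ge1 exprn_even_gt0.
have rest : \sum_(l < d | l != i) z l ^+ 2 = 0.
  apply/eqP; rewrite eq_le sumr_ge0 ?andbT; last by move=> l _; exact: sqr_ge0.
  have : \sum_(l < d) z l ^+ 2 = 1 by exact: h.
  rewrite (bigD1 i)//=; lra.
have zi2 : z i ^+ 2 = 1.
  by have : \sum_(l < d) z l ^+ 2 = 1 by []; rewrite (bigD1 i)//= rest addr0.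
have zl l : l != i -> z l = 0.
  move=> li; apply/eqP; rewrite -sqrf_eq0.
  have := psumr_eq0P (fun l (_ : l != i) => sqr_ge0 (z l)) rest.
  by move=> /(_ l li) ->.
have jE (b : bool) : z i = (-1) ^+ b -> j = step (i, b) n.
  move=> zb; apply/rowP => l; rewrite /step !mxE /=.
  have -> : j ord0 l = n ord0 l + z l by rewrite /z addrC subrK.
  congr (_ + _); have [->|li] := eqVneq l i; first by rewrite zb mulr1.
  by rewrite zl// mulr0.
by have /eqP := zi2; rewrite sqrf_eq1 => /orP[/eqP/(jE false)|/eqP/(jE true)] ->;
  eexists.
Qed.

Lemma step_inj (n : lattice d) : injective (fun k => step k n).
Proof.
move=> [i b] [i' b'] /addrI; rewrite /= => e.
have := congr1 (fun A : lattice d => A ord0 i) e; rewrite !mxE !eqxx/= mulr1.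
have [<-|ii'] := eqVneq i i'; last by rewrite mulr0 => /eqP; rewrite signr_eq0.
by rewrite mulr1; case: b b' {e} => [] [].
Qed.

Lemma fsum_neighbours (R : realType) (u : lattice d -> R[i]) n :
  \sum_(j \in [set j | neighbours j n]) u j = \sum_k u (step k n).
Proof.
rewrite (@reindex_fsbig _ _ _ _ _ (fun k => step k n) [set: 'I_d * bool]).
  have -> : [set: 'I_d * bool] = [set` index_enum ('I_d * bool)%type].
    by apply/seteqP; split=> k //= _; exact: mem_index_enum.
  by rewrite -fsbig_seq ?index_enum_uniq.
split=> [k _|k k' _ _|j /neighboursP[k ->]]; last by exists k.
- by apply/neighboursP; exists k.
- exact: step_inj.
Qed.

End Neighbours.

Section Bridge.
Variables (R : realType) (d : nat).
Local Notation l2 := (l2 R (lattice d)).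
Local Notation H := (l2_hilbert R (lattice d)).
Local Notation "''[' x , y ]" := (dot H x y).
Implicit Types (v w : l2) (m f : lattice d -> R) (c p omega sigma : R).
Implicit Types (z : lattice d -> R[i]).

Lemma modulus_sqr (x : R[i]) : modulus x ^+ 2 = complex.Re x ^+ 2 + complex.Im x ^+ 2.
Proof. by rewrite /modulus normc_def /= sqr_sqrtr// addr_ge0// sqr_ge0. Qed.

Lemma modulus_real (x : R) : modulus x%:C%C = `|x|.
Proof. by rewrite /modulus normc_def /= expr0n addr0 sqrtr_sqr. Qed.

Lemma modulus_ge0 (x : R[i]) : 0 <= modulus x.
Proof. by rewrite /modulus normc_def /= sqrtr_ge0. Qed.

Lemma lp_sum_embed p f : lp_sum p (embed f) = nsum (fun n => `|f n| `^ p).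
Proof. by apply: eq_esum => n _; rewrite modulus_real. Qed.

Lemma in_l2_parts z : in_l2 z ->
  abs_summable (fun n => complex.Re (z n) ^+ 2) /\
  abs_summable (fun n => complex.Im (z n) ^+ 2).
Proof.
move=> zl.
suff h (f : lattice d -> R) : (forall n, f n ^+ 2 <= modulus (z n) ^+ 2) ->
    abs_summable (fun n => f n ^+ 2).
  by split; apply: h => n; rewrite modulus_sqr ?lerDl ?lerDr sqr_ge0.
move=> fz; apply: le_lt_trans zl; apply: le_nsum => n.
by rewrite powR_mulrn ?modulus_ge0// ger0_norm ?sqr_ge0// ?fz.
Qed.

Lemma in_l2_embed f : in_l2 (embed f) <-> abs_summable (fun n => f n ^+ 2).
Proof.
split=> [/in_l2_parts[]//|].
congr (_ < _)%E; rewrite lp_sum_embed; congr nsum; apply/funext => n.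
by rewrite powR_mulrn// real_normK ?num_real// ger0_norm ?sqr_ge0.
Qed.

Lemma in_l2_embed_l2 v : in_l2 (embed v).
Proof. by apply/in_l2_embed; exact: l2P. Qed.

Lemma lp_norm_embed v : lp_norm 2 (embed v) = Num.sqrt '[v, v].
Proof.
rewrite /lp_norm powR12_sqrt; last first.
  by rewrite fine_ge0// lp_sum_embed nsum_ge0// => n; exact: powR_ge0.
congr (Num.sqrt _); rewrite lp_sum_embed l2_dotE isum_nneg; last 2 first.
- by move=> n; rewrite -expr2 sqr_ge0.
- exact: l2_summable.
congr (fine (nsum _)); apply/funext => n.
by rewrite powR_mulrn// real_normK ?num_real.
Qed.

(** The ordered pairs of neighbours are the pairs (n + e, n) for the 2d steps e;
    for each e the sum over n is |S v - v|^2 = 2 |v|^2 - 2 <S v, v>, with S the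
    shift by e. *)
Lemma energyE omega v :
  energy omega (embed v) = '[schr ((2 * d)%:R + omega) (fun=> 0) v, v].
Proof.
have b0 : bounded_values (fun _ : lattice d => 0 : R).
  by exists 0 => n; rewrite normr0.
have -> : '[schr ((2 * d)%:R + omega) (fun=> 0) v, v] =
    (2 * d)%:R * '[v, v] - '[adjacency v, v] + omega * '[v, v].
  rewrite schr_form (_ : mul_op _ v = 0) ?dot0l; first by ring.
  by apply: l2_inj => n; rewrite mul_opE// mul0r.
rewrite /energy; congr (_ + omega * _); last first.
  rewrite l2_dotE isum_nneg; last 2 first.
  - by move=> n; rewrite -expr2 sqr_ge0.
  - exact: l2_summable.
  congr fine; apply: eq_esum => n _.
  by rewrite modulus_real real_normK ?num_real// expr2.
pose g (n : lattice d) k := (v (step k n) - v n : R) ^+ 2.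
have -> : \esum_(e in [set e : lattice d * lattice d | neighbours e.1 e.2])
    (modulus (embed v e.1 - embed v e.2) ^+ 2)%:E =
    (\sum_k nsum (fun n => g n k))%E.
  rewrite (@reindex_esum R _ _ [set: lattice d * ('I_d * bool)] _
     (fun x => (step x.2 x.1, x.1))); last first.
    split=> [[n k] _|[n k] [n' k'] _ _ [+ nn']|[j n] /neighboursP[k /= ->]].
    - by apply/neighboursP; exists k.
    - by rewrite nn' => /step_inj->.
    - by exists (n, k).
  rewrite -esum_sum; last by move=> n k _ _; rewrite lee_fin sqr_ge0.
  transitivity (\esum_(n in [set: lattice d]) \esum_(k in [set: 'I_d * bool]) (g n k)%:E).
    rewrite esum_esum; last by move=> n k _ _; rewrite lee_fin sqr_ge0.
    rewrite (_ : _ `*`` _ = setT); last by apply/seteqP; split.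
    apply: eq_esum => -[n k] _ /=.
    by rewrite /embed -rmorphB modulus_real real_normK ?num_real.
  apply: eq_esum => n _.
  have -> : [set: 'I_d * bool] = [set` index_enum ('I_d * bool)%type].
    by apply/seteqP; split=> k //= _; exact: mem_index_enum.
  rewrite esum_fset; last 2 first.
  - exact: finite_finset.
  - by move=> k _; rewrite lee_fin sqr_ge0.
  by rewrite -fsbig_seq ?index_enum_uniq.
have gE k : nsum (fun n => g n k) = (2 * '[v, v] - 2 * '[shift_op (step k) v, v])%:E.
  have gs : abs_summable (fun n => g n k).
    apply: abs_summable_le (l2P (shift_op (step k) v - v)) => n.
    by rewrite l2D l2N shift_opE//; exact: step_bij.
  rewrite -[LHS]fineK ?nsum_fin// => [|n]; last exact: sqr_ge0.
  congr EFin; rewrite -isum_nneg// => [|n]; last exact: sqr_ge0.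
  transitivity '[shift_op (step k) v - v, shift_op (step k) v - v].
    rewrite l2_dotE; congr isum; apply/funext => n.
    by rewrite -expr2 l2D l2N shift_opE//; exact: step_bij.
  rewrite !dotE shift_op_norm; last exact: step_bij.
  rewrite (dotC H v (shift_op _ _)); ring.
under eq_bigr do rewrite gE.
rewrite sumEFin /= sumrB sumr_const card_steps -mulr_sumr -dot_suml -/(adjacency v).
by rewrite -[X in (X - _) / 2]mulr_natl; move: (2 * d)%:R => D /=; field.
Qed.

Lemma cReD (x y : R[i]) : complex.Re (x + y) = complex.Re x + complex.Re y.
Proof. by case: x => a b; case: y. Qed.
Lemma cImD (x y : R[i]) : complex.Im (x + y) = complex.Im x + complex.Im y.
Proof. by case: x => a b; case: y. Qed.
Lemma cReN (x : R[i]) : complex.Re (- x) = - complex.Re x.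
Proof. by case: x. Qed.
Lemma cImN (x : R[i]) : complex.Im (- x) = - complex.Im x.
Proof. by case: x. Qed.
Lemma cReZ c (x : R[i]) : complex.Re (c%:C%C * x) = c * complex.Re x.
Proof. by case: x => a b /=; rewrite mul0r subr0. Qed.
Lemma cImZ c (x : R[i]) : complex.Im (c%:C%C * x) = c * complex.Im x.
Proof. by case: x => a b /=; rewrite mul0r addr0. Qed.
Lemma cReM (x y : R[i]) : complex.Re (x * y) =
  complex.Re x * complex.Re y - complex.Im x * complex.Im y.
Proof. by case: x => a b; case: y. Qed.
Lemma cImM (x y : R[i]) : complex.Im (x * y) =
  complex.Re x * complex.Im y + complex.Im x * complex.Re y.
Proof. by case: x => a b; case: y. Qed.

Definition schrC c m z n : R[i] :=
  c%:C%C * z n - \sum_k z (step k n) - (m n)%:C%C * z n.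

Lemma laplacianE z n :
  laplacian z n = \sum_k z (step k n) - ((2 * d)%:R : R)%:C%C * z n.
Proof. by rewrite /laplacian fsum_neighbours rmorph_nat. Qed.

Lemma LplusE sigma omega f z n : Lplus sigma omega f z n =
  schrC ((2 * d)%:R + omega) (fun n => (2 * sigma + 1) * f n `^ (2 * sigma)) z n.
Proof. rewrite /Lplus laplacianE /schrC rmorphD; ring. Qed.

Lemma LminusE sigma omega f z n : Lminus sigma omega f z n =
  schrC ((2 * d)%:R + omega) (fun n => f n `^ (2 * sigma)) z n.
Proof. rewrite /Lminus laplacianE /schrC rmorphD; ring. Qed.

Definition reS z : l2 := mkl2 (fun n => complex.Re (z n)).
Definition imS z : l2 := mkl2 (fun n => complex.Im (z n)).

Lemma reSE z n : in_l2 z -> reS z n = complex.Re (z n).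
Proof. by move=> /in_l2_parts[h _]; rewrite mkl2E. Qed.

Lemma imSE z n : in_l2 z -> imS z n = complex.Im (z n).
Proof. by move=> /in_l2_parts[_ h]; rewrite mkl2E. Qed.

Lemma schrC_re c m z n : bounded_values m -> in_l2 z ->
  complex.Re (schrC c m z n) = schr c m (reS z) n.
Proof.
move=> bm zl; rewrite schrE// /schrC !(cReD, cReN, cReZ) reSE//.
rewrite (big_morph _ cReD (id1 := 0))//; congr (_ - _ - _).
by apply: eq_bigr => k _; rewrite reSE.
Qed.

Lemma schrC_im c m z n : bounded_values m -> in_l2 z ->
  complex.Im (schrC c m z n) = schr c m (imS z) n.
Proof.
move=> bm zl; rewrite schrE// /schrC !(cImD, cImN, cImZ) imSE//.
rewrite (big_morph _ cImD (id1 := 0))//; congr (_ - _ - _).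
by apply: eq_bigr => k _; rewrite imSE.
Qed.

Lemma schrC_embed c m v n : bounded_values m ->
  schrC c m (embed v) n = (schr c m v n : R)%:C%C.
Proof.
move=> bm; rewrite schrE// /schrC /embed !rmorphB !rmorphM /=.
by rewrite rmorph_sum.
Qed.

End Bridge.

(** * Inequalities for real powers *)

Section Powers.
Variable R : realType.
Implicit Types (x y r s p : R).

Lemma powRS x r : 0 <= x -> 0 < r -> x `^ (r + 1) = x * x `^ r.
Proof. by move=> x0 r0; rewrite -(@mulr_powRB1 _ x (r + 1)) ?addrK// addr_gt0. Qed.

(** The convex function x^(s + 1) lies above its tangents. This is Young's
    inequality for y and x^s. *)
Lemma powR_tangent x y s : 0 <= x -> 0 <= y -> 0 < s ->
  (s + 1) * x `^ s * (y - x) <= y `^ (s + 1) - x `^ (s + 1).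
Proof.
move=> x0 y0 s0; have s1 : 0 < s + 1 by rewrite addr_gt0.
have q0 : 0 < (s + 1) / s by rewrite divr_gt0.
have sN : s != 0 by rewrite gt_eqF.
have s1N : s + 1 != 0 by rewrite gt_eqF.
have := conjugate_powR y0 (powR_ge0 x s) s1 q0.
rewrite -powRrM (mulrCA s) divff// mulr1 invf_div => /(_ _) h.
have {}h : y * x `^ s <= y `^ (s + 1) / (s + 1) + x `^ (s + 1) * (s / (s + 1)).
  by apply: h; field.
have := ler_wpM2l (ltW s1) h.
have -> : (s + 1) * (y `^ (s + 1) / (s + 1) + x `^ (s + 1) * (s / (s + 1))) =
  y `^ (s + 1) + s * x `^ (s + 1) by field.
rewrite (powRS x0 s0); lra.
Qed.

(** The remainder is nonnegative by the tangent inequality at x, and bounded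
    above by the tangent inequality at y. *)
Lemma powR_remainder x y s : 0 <= x -> 0 <= y -> 0 < s ->
  `|y `^ (s + 1) - x `^ (s + 1) - (s + 1) * x `^ s * (y - x)| <=
  (s + 1) * (`|y `^ s - x `^ s| * `|y - x|).
Proof.
move=> x0 y0 s0; have := powR_tangent x0 y0 s0; have := powR_tangent y0 x0 s0.
move=> h1 h2; rewrite ger0_norm; last by rewrite subr_ge0.
have s1 : 0 <= s + 1 by rewrite addr_ge0// ltW.
rewrite -normrM; apply: le_trans (ler_wpM2l s1 (ler_norm _)).
lra.
Qed.

(** Let G y be the difference of the two sides, up to a constant. By the mean
    value theorem it suffices that G' has the sign of y - x. The tangent
    inequality for the exponent s + 1 reduces this to z^s >= th x^s between y
    and x, which is where the lower bound on y comes from. *)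
Lemma powR_second_order (th x y s : R) : 0 < th < 1 -> 0 < s -> 0 <= x ->
  th `^ s^-1 * x <= y -> 0 <= y ->
  x `^ (s + 2) + (s + 2) * x `^ (s + 1) * (y - x) +
    th * ((s + 2) * (s + 1) / 2) * x `^ s * (y - x) ^+ 2 <= y `^ (s + 2).
Proof.
move=> /andP[th0 th1] s0; rewrite le_eqVlt => /predU1P[<-|x0] xy y0.
  rewrite !powR0 ?gt_eqF ?addr_gt0//.
  by rewrite !(mulr0, mul0r, addr0) powR_ge0.
have s1 : 0 < s + 1 by rewrite addr_gt0.
have s2E : s + 2 = (s + 1) + 1 by rewrite -addrA.
pose k := th * ((s + 2) * (s + 1) / 2) * x `^ s.
pose G z := z `^ (s + 2) - (s + 2) * x `^ (s + 1) * z - k * (z - x) ^+ 2.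
pose dG z := (s + 2) * z `^ (s + 1) - (s + 2) * x `^ (s + 1) - k * (2 * (z - x)).
have derG (z : R) : 0 < z -> is_derive z (1 : R) G (dG z).
  move=> z0; rewrite /G.
  have h1 := is_derive1_powR (s + 2) z0.
  apply: is_derive_eq; rewrite /dG (_ : s + 2 - 1 = s + 1); last by ring.
  by rewrite -![_ *: _]/(_ * _); ring.
have Gmvt (a b : R) : 0 < a -> a < b ->
    exists2 c, a < c < b & G b - G a = dG c * (b - a).
  move=> a0 ab.
  have dG' (z : R) : z \in `]a, b[%R -> is_derive z (1 : R) G (dG z).
    by rewrite in_itv/= => /andP[az _]; apply: derG; exact: lt_trans az.
  have cG : {within `[a, b], continuous G}.
    apply: derivable_within_continuous => z; rewrite in_itv/= => /andP[az _].
    by have [] := derG z (lt_le_trans a0 az).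
  by have [c] := MVT ab dG' cG; rewrite in_itv/=; exists c.
suff : G x <= G y.
  rewrite /G subrr expr0n mulr0 subr0 /k; lra.
have K0 : 0 < (s + 2) * (s + 1) by rewrite mulr_gt0// addr_gt0.
have [xy'|yx|->//] := ltgtP x y.
  have [c /andP[xc _] GE] := Gmvt _ _ x0 xy'; rewrite -subr_ge0 GE.
  rewrite mulr_ge0 ?subr_ge0 ?(ltW xy')//.
  have c0 := lt_trans x0 xc.
  have := ler_wpM2l (ltW (addr_gt0 s0 (ltr0n R 2))) (powR_tangent (ltW x0) (ltW c0) s0).
  have := mulr_ge0 (mulr_ge0 (ltW K0) (powR_ge0 x s)) (ltW (mulr_gt0 (y := 1 - th) (x := c - x) _ _)).
  rewrite !subr_gt0 => /(_ xc th1); rewrite /dG /k; lra.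
have thx : 0 < th `^ s^-1 * x by rewrite mulr_gt0// powR_gt0.
have y1 := lt_le_trans thx xy.
have [c /andP[yc cx] GE] := Gmvt _ _ y1 yx; rewrite -subr_le0 GE.
rewrite mulr_le0_ge0 ?subr_ge0 ?(ltW yx)//.
have c0 := lt_trans y1 yc.
have cs : th * x `^ s <= c `^ s.
  have -> : th * x `^ s = (th `^ s^-1 * x) `^ s.
    rewrite powRM ?powR_ge0 ?(ltW x0)// -powRrM mulVf ?gt_eqF// powRr1//.
    exact: ltW.
  by rewrite ge0_ler_powR ?nnegrE ?(ltW s0) ?(ltW thx) ?(ltW c0)// (le_trans xy)// ltW.
have := ler_wpM2l (ltW (addr_gt0 s0 (ltr0n R 2))) (powR_tangent (ltW c0) (ltW x0) s0).
have := ler_wpM2l (ltW K0) (ler_wpM2r (x := x - c) _ cs).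
rewrite subr_ge0 => /(_ (ltW cx)); rewrite /dG /k; lra.
Qed.

Lemma powR_first_order (x y s : R) : 0 < s -> 0 <= x -> 0 <= y ->
  x `^ (s + 2) + (s + 2) * x `^ (s + 1) * (y - x) <= y `^ (s + 2).
Proof.
move=> s0 x0 y0; have := powR_tangent x0 y0 (addr_gt0 s0 ltr01).
by rewrite -!addrA; lra.
Qed.

(** Young's inequality for the conjugate exponents (s + 2) / s and
    (s + 2) / 2. *)
Lemma powR_young (x y s : R) : 0 < s -> 0 <= x ->
  x `^ s * y ^+ 2 <= s / (s + 2) * x `^ (s + 2) + 2 / (s + 2) * `|y| `^ (s + 2).
Proof.
move=> s0 x0; have s2 : 0 < s + 2 by rewrite addr_gt0.
have := @conjugate_powR _ (x `^ s) (`|y| `^ 2) ((s + 2) / s) ((s + 2) / 2).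
rewrite !powR_ge0 !divr_gt0// -!powRrM.
rewrite (mulrCA s) divff ?gt_eqF// mulr1 (mulrCA 2) divff// mulr1.
rewrite !invf_div powR_mulrn// real_normK ?num_real//.
move=> /(_ isT isT isT isT) h; rewrite ![_ / _ * _]mulrC; apply: h.
by field; rewrite gt_eqF.
Qed.

End Powers.

(** * Consequences of minimality *)

Section Minimizer.
Variables (R : realType) (d : nat) (sigma omega : R) (u : lattice d -> R).
Hypotheses (sigma0 : 0 < sigma) (omega0 : 0 < omega).
Hypothesis (umin : nonneg_minimizer sigma omega u).
Local Notation l2 := (l2 R (lattice d)).
Local Notation H := (l2_hilbert R (lattice d)).
Local Notation "''[' x , y ]" := (dot H x y).
Local Notation s := (2 * sigma).
Local Notation c := ((2 * d)%:R + omega).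
Local Notation j := (@min_energy R d sigma omega).
Implicit Types (v w : l2).

Let s0 : 0 < s. Proof. by rewrite mulr_gt0. Qed.
Let s2 : 0 < s + 2. Proof. by rewrite addr_gt0. Qed.

(** -Delta + omega. *)
Definition free_op v : l2 := schr c (fun=> 0) v.
Local Notation J v := '[free_op v, v].

Lemma bounded_values0 : bounded_values (fun _ : lattice d => 0 : R).
Proof. by exists 0 => n; rewrite normr0. Qed.

Lemma free_op_sym : symmetric_op H free_op.
Proof. exact/schr_sym/bounded_values0. Qed.

Lemma free_op_ge v : omega * '[v, v] <= J v.
Proof.
rewrite schr_form (_ : mul_op _ v = 0) ?dot0l ?subr0; last first.
  by apply: l2_inj => n; rewrite mul_opE ?mul0r//; exact: bounded_values0.
by have := adjacency_le v; rewrite mulrDl; lra.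
Qed.

Lemma schr_free_op m v w : '[schr c m v, w] = '[free_op v, w] - '[mul_op m v, w].
Proof.
rewrite !schr_form (_ : mul_op (fun=> 0) v = 0) ?dot0l ?subr0//.
by apply: l2_inj => n; rewrite mul_opE ?mul0r//; exact: bounded_values0.
Qed.

Definition lp_term v n : R := `|v n| `^ (s + 2).

Lemma lp_term_ge0 v n : 0 <= lp_term v n. Proof. exact: powR_ge0. Qed.

Lemma coord_le_norm v n : `|v n| <= Num.sqrt '[v, v].
Proof. by rewrite -sqrtr_sqr ler_wsqrtr// l2_coord. Qed.

Lemma lp_term_summable v : abs_summable (lp_term v).
Proof.
apply: abs_summable_le (abs_summableZ (Num.sqrt '[v, v] `^ s) (l2P v)) => n.
rewrite !ger0_norm ?lp_term_ge0 ?(mulr_ge0 (powR_ge0 _ _) (sqr_ge0 _))//.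
rewrite /lp_term powRD; last by rewrite gt_eqF.
rewrite powR_mulrn// real_normK ?num_real// ler_wpM2r ?sqr_ge0//.
by rewrite ge0_ler_powR ?nnegrE ?sqrtr_ge0 ?(ltW s0)// coord_le_norm.
Qed.

Lemma lp_norm_eq1 v : isum (lp_term v) = 1 -> lp_norm (s + 2) (embed v) = 1.
Proof.
rewrite isum_nneg//; [|exact: lp_term_ge0|exact: lp_term_summable] => h.
by rewrite /lp_norm lp_sum_embed h powR1.
Qed.

Lemma energy_ge0 z : 0 <= energy (d := d) omega z.
Proof.
rewrite addr_ge0 ?divr_ge0 ?mulr_ge0 ?(ltW omega0)//; apply: fine_ge0;
  by apply: esum_ge0 => x _; rewrite lee_fin sqr_ge0.
Qed.

Lemma min_energy_le w : isum (lp_term w) = 1 -> j <= J w.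
Proof.
move=> w1; rewrite -energyE; apply: ge_inf.
  by exists 0 => _ [z _ <-]; exact: energy_ge0.
by exists (embed w) => //; split; [exact: in_l2_embed_l2|exact: lp_norm_eq1].
Qed.

Definition min_l2 : l2 := mkl2 u.

Lemma min_l2E n : min_l2 n = u n.
Proof. by case: umin => -[/in_l2_embed ul _] _ _; rewrite mkl2E. Qed.

Lemma embed_min_l2 : embed min_l2 = embed u :> (lattice d -> R[i]).
Proof. by apply/funext => n; rewrite /embed min_l2E. Qed.

Lemma min_l2_ge0 n : 0 <= min_l2 n :> R.
Proof. by rewrite min_l2E; case: umin. Qed.

Lemma lp_term_min_l2 : isum (lp_term min_l2) = 1.
Proof.
case: umin => -[_ + _ _]; rewrite /lp_norm -embed_min_l2 lp_sum_embed.
rewrite isum_nneg; [|exact: lp_term_ge0|exact: lp_term_summable].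
move=> /eqP; rewrite powR_eq1 invr_eq0 (gt_eqF s2) orbF => /orP[/eqP//|].
by rewrite ltNge fine_ge0// nsum_ge0// => n; exact: powR_ge0.
Qed.

Lemma free_op_min_l2 : J min_l2 = j.
Proof. by rewrite -energyE embed_min_l2; case: umin. Qed.

Lemma min_l2_neq0 : min_l2 != 0.
Proof.
apply/eqP => u0; have := lp_term_min_l2; rewrite u0 (_ : lp_term 0 = fun=> 0).
  by rewrite isum_nneg ?[nsum _]esum1//= => [/eqP|]; rewrite ?(eq_sym 0) ?oner_eq0//;
     apply: abs_summable_le (lp_term_summable 0) => n; rewrite normr0.
by apply/funext => n; rewrite /lp_term l20 normr0 powR0// gt_eqF.
Qed.

Lemma min_energy_gt0 : 0 < j.
Proof.
rewrite -free_op_min_l2; apply: lt_le_trans (free_op_ge _).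
by rewrite mulr_gt0// (dot_gt0 H)// min_l2_neq0.
Qed.

Lemma isum_lp_term_gt0 v : v != 0 -> 0 < isum (lp_term v).
Proof.
move=> v0; have [n vn] : exists n, v n != 0.
  apply: contrapT => h; move/eqP: v0; apply; apply: l2_inj => n.
  by apply/eqP; apply: contrapT => /negP vn; apply: h; exists n.
have := @seq_le_isum _ _ (lp_term v) [:: n] (lp_term_ge0 v) (lp_term_summable v) isT.
by rewrite big_seq1; apply: lt_le_trans; rewrite powR_gt0// normr_gt0.
Qed.

(** Here a is the norm of w in l^(2 sigma + 2); the inequality is that of
    the definition of j, applied to w / a. *)
Lemma sobolev w (a : R) : 0 < a -> isum (lp_term w) = a `^ (s + 2) -> j * a ^+ 2 <= J w.
Proof.
move=> a0 wa; have := @min_energy_le (a^-1 *: w).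
rewrite (symZ _ free_op_sym) dotZl dotZr.
have -> : isum (lp_term (a^-1 *: w)) = 1.
  transitivity (isum (fun n => a^-1 `^ (s + 2) * lp_term w n)).
    congr isum; apply/funext => n; rewrite /lp_term l2Z normrM powRM//.
    by rewrite ger0_norm// invr_ge0 ltW.
  rewrite isumZ; last exact: lp_term_summable.
  by rewrite wa -powRM ?invr_ge0 ?(ltW a0)// mulVf ?gt_eqF// powR1.
move=> /(_ erefl); rewrite -(ler_pM2r (exprn_gt0 2 a0)).
by rewrite (_ : a^-1 * (a^-1 * J w) * a ^+ 2 = J w)//; field; rewrite gt_eqF.
Qed.

(** The profile of the wave, as an element of the Hilbert space. *)
Definition wave_l2 : l2 := j `^ s^-1 *: min_l2.

Lemma wave_l2_ge0 n : 0 <= wave_l2 n :> R.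
Proof. by rewrite l2Z mulr_ge0 ?powR_ge0 ?min_l2_ge0. Qed.

Lemma wave_l2_neq0 : wave_l2 != 0.
Proof.
apply/eqP => w0; have := congr1 (fun v => (j `^ s^-1)^-1 *: v) w0.
rewrite scalerA mulVf ?scale1r ?scaler0 => [/eqP|]; last first.
  by rewrite gt_eqF// powR_gt0// min_energy_gt0.
by rewrite (negPf min_l2_neq0).
Qed.

Definition wave_pot n : R := wave_l2 n `^ s.

Lemma wave_potE n : wave_pot n = j * min_l2 n `^ s.
Proof.
rewrite /wave_pot l2Z powRM ?powR_ge0 ?min_l2_ge0// -powRrM mulVf ?gt_eqF//.
by rewrite powRr1// ltW// min_energy_gt0.
Qed.

Lemma wave_pot_bounded : bounded_values wave_pot.
Proof.
exists (Num.sqrt '[wave_l2, wave_l2] `^ s) => n.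
rewrite ger0_norm ?powR_ge0// ge0_ler_powR ?nnegrE ?sqrtr_ge0 ?wave_l2_ge0 ?(ltW s0)//.
by rewrite (le_trans _ (coord_le_norm _ n))// ler_norm.
Qed.

Lemma mul_wave_pot v w : '[mul_op wave_pot v, w] =
  j * isum (fun n => (min_l2 n : R) `^ s * (v n * w n)).
Proof.
have -> : isum (fun n => (min_l2 n : R) `^ s * (v n * w n)) =
    isum (fun n => j^-1 * (mul_op wave_pot v n * w n)).
  congr isum; apply/funext => n.
  rewrite (mul_opE _ _ wave_pot_bounded) wave_potE.
  have := min_energy_gt0; move: (v n : R) (w n : R) => x y j0.
  by field; rewrite gt_eqF.
rewrite isumZ; last exact: l2_summable.
by rewrite mulrA divff ?mul1r// gt_eqF// min_energy_gt0.
Qed.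

Definition lminus : l2 -> l2 := schr c wave_pot.
Definition lplus : l2 -> l2 := schr c (fun n => (s + 1) * wave_pot n).

Lemma lp_weight_summable v w : abs_summable (fun n => (min_l2 n : R) `^ s * (v n * w n)).
Proof.
have := l2_summable (mul_op wave_pot v) w.
move=> /(abs_summableZ j^-1); apply: abs_summable_le => n.
rewrite (mul_opE _ _ wave_pot_bounded) wave_potE.
rewrite le_eqVlt; apply/orP; left; apply/eqP; congr `|_|.
have := min_energy_gt0; move: (v n : R) (w n : R) => x y j0.
by field; rewrite gt_eqF.
Qed.

(** With u the minimizer and a the norm of w, Young's inequality bounds
    u^(2 sigma) (w / a)^2 termwise, and the bounds add up to 1 because u and
    w / a both have norm 1. So the potential term is at most j a^2, which is at
    most J[w]. *)
Lemma lminus_ge0 w : 0 <= '[lminus w, w].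
Proof.
have [->|w0] := eqVneq w 0; first by rewrite dot0r.
pose a := isum (lp_term w) `^ (s + 2)^-1.
have a0 : 0 < a by rewrite powR_gt0 ?isum_lp_term_gt0.
have aE : isum (lp_term w) = a `^ (s + 2).
  by rewrite /a -powRrM mulVf ?gt_eqF// powRr1// ltW// isum_lp_term_gt0.
rewrite schr_free_op mul_wave_pot subr_ge0; apply: le_trans (sobolev a0 aE).
rewrite ler_pM2l ?min_energy_gt0//.
have a2 : 0 < a ^+ 2 by rewrite exprn_gt0.
rewrite -(ler_pM2l (x := (a ^+ 2)^-1)) ?invr_gt0// mulVf ?gt_eqF//.
rewrite -isumZ; last exact: lp_weight_summable.
have su := abs_summableZ (s / (s + 2)) (lp_term_summable min_l2).
have sw := abs_summableZ (2 / (s + 2) / a `^ (s + 2)) (lp_term_summable w).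
apply: (@le_trans _ _ (isum (fun n => s / (s + 2) * lp_term min_l2 n +
    2 / (s + 2) / a `^ (s + 2) * lp_term w n))).
  apply: le_isum => [||n].
  - exact/abs_summableZ/lp_weight_summable.
  - exact: abs_summableD.
  have := powR_young (w n / a) s0 (min_l2_ge0 n).
  rewrite normrM powRM// (ger0_norm (_ : 0 <= a^-1)) ?invr_ge0 ?(ltW a0)//.
  rewrite /lp_term (ger0_norm (min_l2_ge0 n)) exprMn exprVn.
  have -> : a^-1 `^ (s + 2) = (a `^ (s + 2))^-1.
    apply: (mulIf (_ : a `^ (s + 2) != 0)); first by rewrite gt_eqF// powR_gt0.
    rewrite -powRM ?invr_ge0 ?(ltW a0)// !mulVf ?powR1// gt_eqF// powR_gt0//.
  rewrite expr2; lra.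
rewrite isumD// !isumZ ?lp_term_min_l2 ?aE; try exact: lp_term_summable.
have apN : a `^ (s + 2) != 0 by rewrite gt_eqF// powR_gt0.
by rewrite (divfK apN) mulr1 -mulrDl divff// gt_eqF.
Qed.

Lemma lminus_sym : symmetric_op H lminus.
Proof. exact/schr_sym/wave_pot_bounded. Qed.

Lemma scaled_wave_pot_bounded : bounded_values (fun n => (s + 1) * wave_pot n).
Proof.
case: wave_pot_bounded => M hM; exists ((s + 1) * M) => n.
by rewrite normrM ger0_norm ?ler_pM2l// ?addr_ge0 ?(ltW s0)// addr_gt0.
Qed.

Lemma lplus_sym : symmetric_op H lplus.
Proof. exact/schr_sym/scaled_wave_pot_bounded. Qed.

Lemma lplus_form v w : '[lplus v, w] = '[lminus v, w] - s * '[mul_op wave_pot v, w].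
Proof.
have /(congr1 (fun x => '[x, w])) : mul_op (fun n => (s + 1) * wave_pot n) v =
    (s + 1) *: mul_op wave_pot v.
  apply: l2_inj => n; rewrite l2Z (mul_opE _ _ wave_pot_bounded).
  by rewrite (mul_opE _ _ scaled_wave_pot_bounded) mulrA.
have h1 := schr_free_op (fun n => (s + 1) * wave_pot n) v w.
have h2 := schr_free_op wave_pot v w.
by rewrite dotZl -/lplus -/lminus in h1 h2 * => hm; rewrite h1 h2 hm; ring.
Qed.

(** The Euler-Lagrange equation: the nonnegative form of L- vanishes at u. *)
Lemma lminus_min_l2 : lminus min_l2 = 0.
Proof.
apply: psd_ker lminus_sym lminus_ge0 _; rewrite schr_free_op mul_wave_pot free_op_min_l2.
rewrite (_ : (fun n => _) = lp_term min_l2) ?lp_term_min_l2 ?mulr1 ?subrr//.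
apply/funext => n; rewrite /lp_term (ger0_norm (min_l2_ge0 n)).
rewrite powRD; last by rewrite gt_eqF.
by rewrite powR_mulrn ?min_l2_ge0.
Qed.

Lemma lminus_wave : lminus wave_l2 = 0.
Proof. by rewrite (symZ _ lminus_sym) lminus_min_l2 scaler0. Qed.

(** A step t <= dl keeps u + t v above rho u at all the sites of F. *)
Lemma common_step (F : seq (lattice d)) v (rho : R) : rho < 1 ->
  exists2 dl : R, 0 < dl & forall n, n \in F -> 0 < min_l2 n :> R ->
    dl * `|v n| <= (1 - rho) * min_l2 n.
Proof.
move=> r1; elim: F => [|n F [dl dl0 hdl]]; first by exists 1.
have [un|un] := ltP (0 : R) (min_l2 n); last first.
  exists dl => // k; rewrite inE => /predU1P[->|kF]; last exact: hdl.
  by rewrite ltNge un.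
pose e := (1 - rho) * min_l2 n / (`|v n| + 1).
have vn1 : 0 < `|v n| + 1 :> R by rewrite ltr_wpDl.
exists (Num.min dl e) => [|k].
  by rewrite lt_min dl0 divr_gt0// mulr_gt0// subr_gt0.
rewrite inE => /predU1P[-> _|kF uk].
  apply: (@le_trans _ _ (e * `|v n|)); first by rewrite ler_wpM2r// ge_min lexx orbT.
  rewrite mulrAC ler_pdivrMr// ler_pM2l ?lerDl//.
  by rewrite mulr_gt0// subr_gt0.
apply: le_trans (hdl k kF uk).
by rewrite ler_wpM2r// ge_min lexx.
Qed.

(** At the sites of F the expansion is taken to second order, and elsewhere
    convexity gives the first order. Since only lower bounds are needed, no
    uniformity over the lattice is required. *)
Lemma lp_term_expansion (F : seq (lattice d)) v (th : R) : uniq F -> 0 < th < 1 ->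
  isum (fun n => (min_l2 n : R) `^ s * (min_l2 n * v n)) = 0 ->
  exists2 dl : R, 0 < dl & forall t, 0 < t <= dl ->
    1 + t ^+ 2 * (th * ((s + 2) * (s + 1) / 2) *
      \sum_(n <- F) (min_l2 n : R) `^ s * (v n * v n))
    <= isum (lp_term (min_l2 + t *: v)).
Proof.
move=> uF th01 uv0; have /andP[th0 th1] := th01.
have rho1 : th `^ s^-1 < 1.
  have := @gt0_ltr_powR _ s^-1 _ th 1; rewrite powR1 invr_gt0 !nnegrE.
  by move=> /(_ s0 (ltW th0) ler01 th1).
have [dl dl0 hdl] := common_step F v rho1.
exists dl => // t /andP[t0 tdl].
pose base n : R := lp_term min_l2 n + (s + 2) * t * ((min_l2 n : R) `^ s * (min_l2 n * v n)).
have sbase : abs_summable base.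
  apply: abs_summableD; first exact: lp_term_summable.
  exact/abs_summableZ/lp_weight_summable.
have ibase : isum base = 1.
  rewrite isumD ?isumZ ?uv0 ?lp_term_min_l2 ?mulr0 ?addr0//.
  - exact: lp_weight_summable.
  - exact: lp_term_summable.
  - exact/abs_summableZ/lp_weight_summable.
pose rem n : R := lp_term (min_l2 + t *: v) n + (- 1) * base n.
have srem : abs_summable rem.
  apply: abs_summableD; first exact: lp_term_summable.
  exact: abs_summableZ.
have baseE n : base n = (min_l2 n : R) `^ (s + 2) +
    (s + 2) * (min_l2 n : R) `^ (s + 1) * (min_l2 n + t * v n - min_l2 n).
  rewrite /base /lp_term (ger0_norm (min_l2_ge0 n)) (powRS (min_l2_ge0 n) s0).
  by move: (min_l2 n : R) (v n : R) => x y; ring.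
have rem0 n : 0 <= rem n.
  rewrite /rem mulN1r subr_ge0 baseE /lp_term l2D l2Z.
  apply: le_trans (powR_first_order s0 (min_l2_ge0 n) (normr_ge0 _)).
  rewrite lerD2l ler_wpM2l ?mulr_ge0 ?powR_ge0 ?(ltW s2)//.
  by rewrite lerD2r ler_norm.
have -> : isum (lp_term (min_l2 + t *: v)) = 1 + isum rem.
  rewrite isumD ?isumZ ?ibase//; last 2 first.
  - exact: lp_term_summable.
  - exact: abs_summableZ.
  by ring.
rewrite lerD2l; apply: le_trans (seq_le_isum rem0 srem uF).
rewrite !mulr_sumr big_seq [leRHS]big_seq; apply: ler_sum => n nF.
rewrite /rem mulN1r baseE /lp_term l2D l2Z.
have := min_l2_ge0 n; rewrite le_eqVlt => /predU1P[<-|un].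
  rewrite !powR0 ?gt_eqF ?addr_gt0//.
  by rewrite !(mulr0, mul0r, addr0, subr0) powR_ge0.
have yl : th `^ s^-1 * min_l2 n <= min_l2 n + t * v n.
  have := hdl n nF un; have := ler_wpM2r (normr_ge0 (v n)) tdl.
  have := ler_wpM2l (ltW t0) (ler_norm (- v n)); rewrite normrN; lra.
have y0 : 0 <= min_l2 n + t * v n :> R.
  by apply: le_trans yl; rewrite mulr_ge0 ?powR_ge0// ltW.
have := powR_second_order th01 s0 (ltW un) yl y0.
rewrite (ger0_norm y0).
move: (min_l2 n : R) (v n : R) => x y; rewrite (addrC x) addrK exprMn expr2.
lra.
Qed.

(** Let B = J[v] / j. Since u is critical, J[u + t v] = j (1 + t^2 B), so the
    l^(2 sigma + 2) norm of u + t v has a square of at most 1 + t^2 B. The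
    lower bound 1 + t^2 K for its power of exponent 2 sigma + 2 then gives
    K <= (sigma + 1) B in the limit t -> 0. The factor th^2 in [key] is the
    price for taking t and the expansion at finite accuracy; one factor comes
    from the expansion and one from the power of 1 + t^2 B. *)
Lemma second_variation v :
  isum (fun n => (min_l2 n : R) `^ s * (min_l2 n * v n)) = 0 -> 0 <= '[lplus v, v].
Proof.
move=> uv0; have j0 := min_energy_gt0.
pose B := J v / j.
have Jv0 : 0 <= J v.
  by apply: le_trans (free_op_ge v); rewrite mulr_ge0 ?(ltW omega0)// dot_ge0.
have B0 : 0 <= B by rewrite divr_ge0// ltW.
have JE t : J (min_l2 + t *: v) = j * (1 + t ^+ 2 * B).
  rewrite (symD free_op_sym) (symZ _ free_op_sym) dotDl !dotDr !dotZl !dotZr.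
  have uv : '[free_op min_l2, v] = 0.
    have := schr_free_op wave_pot min_l2 v.
    rewrite -/(lminus _) lminus_min_l2 dot0l mul_wave_pot uv0 mulr0 subr0.
    by move=> <-.
  rewrite free_op_min_l2 uv (free_op_sym v) (dotC H v) uv /B.
  by field; rewrite gt_eqF.
have key (F : seq (lattice d)) (th : R) : uniq F -> 0 < th < 1 ->
    th ^+ 2 * ((s + 2) * (s + 1) / 2 *
      \sum_(n <- F) (min_l2 n : R) `^ s * (v n * v n)) <= (s / 2 + 1) * B.
  move=> uF /[dup] th01 /andP[th0 th1].
  have [dl dl0 hdl] := lp_term_expansion uF th01 uv0.
  have M1 : 1 < th^-1 `^ (s / 2)^-1.
    have := @gt0_ltr_powR _ (s / 2)^-1 _ 1 th^-1; rewrite powR1 !nnegrE.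
    rewrite invr_gt0 divr_gt0// invr_ge0 (ltW th0) ler01 invf_gt1// th1.
    by move=> /(_ isT isT isT isT).
  pose eta := th^-1 `^ (s / 2)^-1 - 1.
  have eta0 : 0 < eta by rewrite subr_gt0.
  pose t := Num.min dl (Num.min 1 (eta / (B + 1))).
  have B1 : 0 < B + 1 by rewrite ltr_wpDl.
  have t0 : 0 < t by rewrite !lt_min dl0 ltr01 divr_gt0.
  have tdl : 0 < t <= dl by rewrite t0 /t ge_min lexx.
  have t1 : t <= 1 by rewrite /t !ge_min lexx orbT.
  have te : t * (B + 1) <= eta.
    by rewrite -ler_pdivlMr// /t !ge_min lexx !orbT.
  pose X := 1 + t ^+ 2 * B.
  have X1 : 1 <= X by rewrite lerDl mulr_ge0// sqr_ge0.
  have X0 : 0 < X by apply: lt_le_trans X1.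
  have Xe : X `^ (s / 2) <= th^-1.
    have -> : th^-1 = (th^-1 `^ (s / 2)^-1) `^ (s / 2).
      by rewrite -powRrM mulVf ?powRr1// ?invr_ge0 ?(ltW th0)// gt_eqF// divr_gt0.
    rewrite ge0_ler_powR ?nnegrE ?powR_ge0 ?(ltW X0)// ?divr_ge0 ?(ltW s0)//.
    rewrite -lerBlDl in te *.
    have : t ^+ 2 * B <= t * B by rewrite ler_wpM2r// expr2 ger_pMr.
    by rewrite /X; move: te; rewrite /eta; lra.
  set A := \sum_(n <- F) _.
  have := hdl t tdl; rewrite -/A => hP.
  have P0 : 0 < isum (lp_term (min_l2 + t *: v)).
    apply: lt_le_trans hP; rewrite ltr_pwDl//.
    rewrite mulr_ge0 ?sqr_ge0// mulr_ge0//.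
      by rewrite mulr_ge0 ?(ltW th0)// divr_ge0// mulr_ge0// ltW// addr_gt0.
    apply: sumr_ge0 => n _; rewrite mulr_ge0 ?powR_ge0// -expr2; exact: sqr_ge0.
  pose a := isum (lp_term (min_l2 + t *: v)) `^ (s + 2)^-1.
  have a0 : 0 < a by rewrite powR_gt0.
  have aE : isum (lp_term (min_l2 + t *: v)) = a `^ (s + 2).
    by rewrite /a -powRrM mulVf ?gt_eqF// powRr1// ltW.
  have aX : a ^+ 2 <= X.
    by have := sobolev a0 aE; rewrite JE ler_pM2l.
  have s2E : s + 2 = 2 * (s / 2 + 1) by field.
  have : a `^ (s + 2) <= X `^ (s / 2 + 1).
    rewrite s2E powRrM powR_mulrn ?(ltW a0)//.
    by rewrite ge0_ler_powR ?nnegrE ?(ltW X0) ?exprn_ge0 ?(ltW a0)// ?addr_ge0 ?divr_ge0 ?(ltW s0).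
  rewrite -aE => h1; have {h1} := le_trans hP h1.
  have sh0 : 0 < s / 2 by rewrite divr_gt0.
  have := powR_tangent (ltW X0) ler01 sh0; rewrite powR1 => h2 h3.
  have {h2 h3} : t ^+ 2 * (th * ((s + 2) * (s + 1) / 2) * A) <=
      t ^+ 2 * ((s / 2 + 1) * X `^ (s / 2) * B).
    by move: h2; rewrite {2}/X; lra.
  rewrite ler_pM2l ?exprn_gt0// => h.
  have h4 : (s / 2 + 1) * X `^ (s / 2) * B <= (s / 2 + 1) * th^-1 * B.
    by rewrite ler_wpM2r// ler_wpM2l// addr_ge0// ltW.
  have := ler_wpM2l (ltW th0) (le_trans h h4).
  have -> : th * ((s / 2 + 1) * th^-1 * B) = (s / 2 + 1) * B.
    by field; rewrite gt_eqF.
  rewrite expr2; lra.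
have fin (F : seq (lattice d)) : uniq F ->
    \sum_(n <- F) (min_l2 n : R) `^ s * (v n * v n) <= B / (s + 1).
  move=> uF; set A := \sum_(n <- F) _.
  have s1 : 0 < s + 1 by rewrite addr_gt0.
  rewrite ler_pdivlMr// leNgt; apply/negP => hA.
  have A0 : 0 < A * (s + 1) by apply: le_lt_trans hA.
  (* th^2 = (1 + r) / 2 lies strictly between r and 1 *)
  pose r := B / (A * (s + 1)).
  have r0 : 0 <= r by rewrite divr_ge0// ltW.
  have r1 : r < 1 by rewrite ltr_pdivrMr// mul1r.
  have th01 : 0 < Num.sqrt ((1 + r) / 2) < 1.
    rewrite sqrtr_gt0; apply/andP; split; first by rewrite divr_gt0// ltr_pwDl.
    by rewrite -[ltRHS]sqrtr1 ltr_sqrt// ltr_pdivrMr//; lra.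
  have := key F _ uF th01; rewrite -/A sqr_sqrtr; last by rewrite divr_ge0// addr_ge0.
  have BE : B = r * (A * (s + 1)) by rewrite /r divfK// gt_eqF.
  apply/negP; rewrite -ltNge {1}BE -subr_gt0.
  have -> : (1 + r) / 2 * ((s + 2) * (s + 1) / 2 * A) - (s / 2 + 1) * (r * (A * (s + 1)))
    = (1 - r) * ((A * (s + 1)) * (s + 2)) / 4 by field.
  by rewrite divr_gt0// mulr_gt0 ?subr_gt0// mulr_gt0.
have uvv n : 0 <= (min_l2 n : R) `^ s * (v n * v n).
  by rewrite mulr_ge0 ?powR_ge0// -expr2 sqr_ge0.
have [_ hsum] := summable_bound uvv fin.
rewrite lplus_form schr_free_op mul_wave_pot.
have s1 : 0 < s + 1 by rewrite addr_gt0.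
have := ler_wpM2l (ltW (mulr_gt0 j0 s1)) hsum.
have -> : j * (s + 1) * (B / (s + 1)) = J v.
  by rewrite /B; field; rewrite !gt_eqF.
lra.
Qed.

Lemma wave_l2_gt0 n : 0 < wave_l2 n :> R.
Proof.
rewrite lt_def wave_l2_ge0 andbT; apply/eqP => wn.
have := schr_max_principle wave_pot_bounded wave_l2_ge0 lminus_wave wn.
by apply/eqP; exact: wave_l2_neq0.
Qed.

(** If v is in the kernel then so is |v|, because its form is not larger. One
    of |v| + v and |v| - v vanishes at a given site, hence everywhere by the
    maximum principle. So v has a constant sign, and cannot be orthogonal to the
    positive phi unless it is 0. *)
Lemma lminus_ker v : '[wave_l2, v] = 0 -> lminus v = 0 -> v = 0.
Proof.
move=> wv Lv; apply: l2_inj => n; rewrite l20; apply/eqP; apply: contraT => vn.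
have Labs : lminus (abs_l2 v) = 0.
  apply: psd_ker lminus_sym lminus_ge0 _; apply/eqP; rewrite eq_le lminus_ge0 andbT.
  by apply: le_trans (abs_l2_form c v wave_pot_bounded) _; rewrite -/lminus Lv dot0l.
(* e is the sign for which |v| + e v vanishes at the site n *)
have sign (e : R) : `|v n| + e * v n = 0 -> e = 1 \/ e = -1 -> abs_l2 v = - e *: v.
  move=> vne e1.
  suff : abs_l2 v + e *: v = 0 by move=> /eqP; rewrite addr_eq0 scaleNr => /eqP.
  apply: (@schr_max_principle _ _ c wave_pot _ n wave_pot_bounded).
  - move=> i; rewrite l2D l2Z abs_l2E.
    case: e1 => ->; rewrite ?mul1r ?mulN1r; first exact: norm_add_ge0.
    by rewrite subr_ge0 ler_norm.
  - by rewrite -/lminus (symD lminus_sym) (symZ _ lminus_sym) Labs Lv scaler0 addr0.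
  - by rewrite l2D l2Z abs_l2E.
have [e absv] : exists e, abs_l2 v = e *: v.
  have [vn0|vn0] := leP 0 (v n : R).
    exists (- (- 1)); apply: sign; last by right.
    by rewrite ger0_norm// mulN1r subrr.
  exists (- 1); apply: sign; last by left.
  by rewrite ltr0_norm// mul1r addrC subrr.
have pos i : 0 <= wave_l2 i * abs_l2 v i :> R.
  by rewrite abs_l2E mulr_ge0// wave_l2_ge0.
have := @seq_le_isum _ _ (fun i => wave_l2 i * abs_l2 v i) [:: n] pos (l2_summable _ _) isT.
rewrite big_seq1 -l2_dotE absv dotZr wv mulr0 -absv abs_l2E.
by rewrite leNgt mulr_gt0 ?wave_l2_gt0// normr_gt0.
Qed.

Lemma wave_pot_tail : exists F : seq (lattice d), forall n, n \notin F ->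
  (s + 1) * wave_pot n <= omega / 2.
Proof.
have s1 : 0 < s + 1 by rewrite addr_gt0.
pose e := (omega / 2 / (s + 1)) `^ s^-1.
have e0 : 0 < e by rewrite powR_gt0// !divr_gt0.
have [F hF] := l2_tail wave_l2 e0; exists F => n /hF/ltW h.
rewrite mulrC -ler_pdivlMr//.
have -> : omega / 2 / (s + 1) = e `^ s.
  by rewrite /e -powRrM mulVf ?gt_eqF// powRr1// ltW// !divr_gt0.
rewrite ge0_ler_powR ?nnegrE ?(ltW s0) ?(ltW e0) ?wave_l2_ge0//.
by apply: le_trans h; rewrite ler_norm.
Qed.

Lemma wave_vk_pair : (forall v, lplus v = 0 -> v = 0) ->
  vk_pair H lplus lminus wave_l2.
Proof.
move=> inj; have [F hF] := wave_pot_tail; split.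
- exact: lplus_sym.
- exact: lminus_sym.
- exact/schr_bounded/scaled_wave_pot_bounded.
- exact/schr_bounded/wave_pot_bounded.
- by eexists; apply: schr_tail hF => //; exact: scaled_wave_pot_bounded.
- eexists; apply: (@schr_tail _ _ omega _ F) => //; first exact: wave_pot_bounded.
  move=> n /hF; apply: le_trans.
  by rewrite ler_peMl ?powR_ge0// lerDr ltW.
- exact: inj.
- exact: wave_l2_neq0.
- exact: lminus_ge0.
- exact: lminus_wave.
- exact: lminus_ker.
- move=> v; rewrite lplus_form lminus_wave dot0l sub0r mul_wave_pot => /eqP.
  rewrite oppr_eq0 mulf_eq0 (gt_eqF s0) mulf_eq0 (gt_eqF min_energy_gt0) !orFb.
  move=> /eqP wv; apply: second_variation.
  have := congr1 (fun x => (j `^ s^-1)^-1 * x) wv.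
  rewrite mulr0 -isumZ; last exact: lp_weight_summable.
  move=> <-; congr isum; apply/funext => n; rewrite l2Z.
  have : 0 < j `^ s^-1 by rewrite powR_gt0// min_energy_gt0.
  move: (min_l2 n : R) (v n : R) (j `^ s^-1) => x y k k0.
  by field; rewrite gt_eqF.
- rewrite lplus_form lminus_wave dot0l sub0r oppr_le0 mulr_ge0 ?(ltW s0)//.
  rewrite mul_wave_pot mulr_ge0 ?(ltW min_energy_gt0)// isum_ge0// => n.
  by rewrite mulr_ge0 ?powR_ge0// -expr2 sqr_ge0.
Qed.

End Minimizer.

(** * Dependence on the frequency, and stability *)

Section Frequency.
Variable R : realType.

(** Let x <= y. For y up to e^(1/s) both powers are at most e. Beyond it, y - x <= eta
    forces x >= rho y, so that x^s >= tau y^s, where tau is so close to 1 that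
    M^s (1 - tau) <= e. *)
Lemma powR_uniform_continuous (s M e : R) : 0 < s -> 0 < e ->
  exists2 eta : R, 0 < eta & forall x y : R, 0 <= x <= M -> 0 <= y <= M ->
    `|y - x| <= eta -> `|y `^ s - x `^ s| <= e.
Proof.
move=> s0 e0.
pose e1 := e `^ s^-1; have e10 : 0 < e1 by rewrite powR_gt0.
have e1s : e1 `^ s = e by rewrite /e1 -powRrM mulVf ?gt_eqF// powRr1// ltW.
have Ms1 : 0 < M `^ s + 1 by rewrite ltr_wpDl// powR_ge0.
pose tau := Num.max 2^-1 (1 - e / (M `^ s + 1)).
have tau0 : 0 < tau by rewrite lt_max invr_gt0 ltr0n.
have tau1 : tau < 1.
  by rewrite gt_max invf_lt1 ?ltr1n//= ltrBlDl ltrDr divr_gt0.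
have tauM : M `^ s * (1 - tau) <= e.
  have h : 1 - tau <= e / (M `^ s + 1) by rewrite lerBlDl -lerBlDr le_max lexx orbT.
  apply: le_trans (ler_wpM2l (powR_ge0 M s) h) _.
  by rewrite mulrA ler_pdivrMr// mulrC ler_pM2l// lerDl.
pose rho := tau `^ s^-1.
have rho0 : 0 < rho by rewrite powR_gt0.
have rhos : rho `^ s = tau by rewrite /rho -powRrM mulVf ?gt_eqF// powRr1// ltW.
have rho1 : rho < 1.
  have := @gt0_ltr_powR _ s^-1 _ tau 1; rewrite powR1 invr_gt0 !nnegrE.
  by move=> /(_ s0 (ltW tau0) ler01 tau1).
exists ((1 - rho) * e1) => [|x y]; first by rewrite mulr_gt0// subr_gt0.
wlog xy : x y / x <= y => [hw|].
  have [/hw//|/ltW/hw h] := leP x y => hx hy.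
  by rewrite distrC [in X in _ -> X]distrC; exact: h.
move=> /andP[x0 xM] /andP[y0 yM] hxy.
have xys : x `^ s <= y `^ s by rewrite ge0_ler_powR ?nnegrE// ltW.
rewrite ger0_norm ?subr_ge0// in hxy *; rewrite ger0_norm ?subr_ge0//.
have [ye|ye] := leP y e1.
  rewrite lerBlDr (@le_trans _ _ e) ?lerDl ?powR_ge0// -e1s.
  by rewrite ge0_ler_powR ?nnegrE ?(ltW s0)// ltW.
have rx : rho * y <= x.
  have rho1' : 0 <= 1 - rho by rewrite subr_ge0 ltW.
  have := le_trans hxy (ler_wpM2l rho1' (ltW ye)).
  by rewrite mulrBl mul1r lerD2l lerN2.
have : tau * y `^ s <= x `^ s.
  rewrite -rhos -powRM ?(ltW rho0)// ge0_ler_powR ?nnegrE ?(ltW s0)//.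
  by rewrite mulr_ge0// ltW.
move=> xy'; have yMs : y `^ s <= M `^ s.
  by rewrite ge0_ler_powR ?nnegrE ?(ltW s0)// (le_trans y0).
have t1 : 0 <= 1 - tau by rewrite subr_ge0 ltW.
apply: le_trans (le_trans (ler_wpM2l t1 yMs) _); last by rewrite mulrC.
by rewrite mulrBl mul1r lerD2l lerN2.
Qed.

Variables (d : nat) (sigma : R) (u : R -> lattice d -> R).
Hypothesis sigma0 : 0 < sigma.
Hypothesis umin : forall omega : R, 0 < omega -> nonneg_minimizer sigma omega (u omega).
Local Notation l2 := (l2 R (lattice d)).
Local Notation H := (l2_hilbert R (lattice d)).
Local Notation "''[' x , y ]" := (dot H x y).
Local Notation s := (2 * sigma).
Local Notation Phi x := (wave_l2 sigma x (u x)).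
Local Notation Lp x := (lplus sigma x (u x)).

Let s0 : 0 < s. Proof. by rewrite mulr_gt0. Qed.

Lemma wave_l2E (x : R) n : 0 < x -> Phi x n = wave sigma u x n :> R.
Proof. by move=> x0; rewrite l2Z (min_l2E (umin x0)). Qed.

Lemma embed_wave (x : R) : 0 < x ->
  embed (wave sigma u x) = embed (Phi x) :> (lattice d -> R[i]).
Proof. by move=> x0; apply/funext => n; rewrite /embed wave_l2E. Qed.

(** The difference of the equations of the waves of frequencies omega + h and
    omega is L+ dl + h phi' = phi'^(s + 1) - phi^(s + 1) - (s + 1) phi^s dl,
    with phi' the wave of frequency omega + h and s = 2 sigma. *)
Lemma linearization_remainder (omega h : R) (e : R) (dl r : l2) :
  0 < omega -> 0 < omega + h -> 0 <= e ->
  (forall n, (s + 1) * `|(Phi (omega + h) n : R) `^ s - (Phi omega n : R) `^ s| <= e) ->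
  dl = Phi (omega + h) - Phi omega ->
  r = Lp omega dl + h *: Phi (omega + h) ->
  '[r, r] <= e ^+ 2 * '[dl, dl].
Proof.
move=> o0 oh0 e0 hpot dlE rE0.
have s1 : 0 <= s + 1 by rewrite addr_ge0// ltW.
have rE n : r n = (Phi (omega + h) n : R) `^ (s + 1) - (Phi omega n : R) `^ (s + 1)
    - (s + 1) * (Phi omega n : R) `^ s * ((Phi (omega + h) n : R) - Phi omega n).
  have /(congr1 (fun v : l2 => v n : R)) := lminus_wave sigma0 oh0 (umin oh0).
  have /(congr1 (fun v : l2 => v n : R)) := lminus_wave sigma0 o0 (umin o0).
  rewrite /lminus (schrE _ _ _ (wave_pot_bounded sigma0 (umin o0))).
  rewrite (schrE _ _ _ (wave_pot_bounded sigma0 (umin oh0))) !l20.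
  have -> : r n = Lp omega dl n + h * Phi (omega + h) n by rewrite rE0 l2D l2Z.
  rewrite /lplus (schrE _ _ _ (scaled_wave_pot_bounded sigma0 (umin o0))).
  have -> : \sum_k dl (step k n) =
      \sum_k Phi (omega + h) (step k n) - \sum_k Phi omega (step k n) :> R.
    by rewrite -sumrB; apply: eq_bigr => k _; rewrite dlE l2D l2N.
  have -> : dl n = (Phi (omega + h) n : R) - Phi omega n by rewrite dlE l2D l2N.
  rewrite (powRS (wave_l2_ge0 (umin o0) n) s0).
  rewrite (powRS (wave_l2_ge0 (umin oh0) n) s0) /wave_pot.
  move: (Phi (omega + h) n : R) (Phi omega n : R) => x y.
  move: (\sum_k _ : R) (\sum_k _ : R) => X Y h1 h2.
  lra.
rewrite !l2_dotE -isumZ; last exact: l2_summable.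
apply: le_isum; [exact: l2_summable|exact/abs_summableZ/l2_summable|move=> n].
have -> : dl n = (Phi (omega + h) n : R) - Phi omega n by rewrite dlE l2D l2N.
rewrite rE -!expr2 -exprMn -real_normK ?num_real// -[leRHS]real_normK ?num_real//.
rewrite lerXn2r ?nnegrE// normrM (ger0_norm e0).
apply: le_trans (powR_remainder (wave_l2_ge0 (umin o0) n) (wave_l2_ge0 (umin oh0) n) s0) _.
by rewrite mulrA ler_wpM2r.
Qed.

Lemma norm_le_sqrt (x y b : R) : 0 <= y -> x ^+ 2 <= b * y ^+ 2 -> `|x| <= Num.sqrt b * y.
Proof.
move=> y0 h; rewrite -sqrtr_sqr -[X in _ * X](ger0_norm y0) -sqrtr_sqr.
have [b0|b0] := leP 0 b; first by rewrite -sqrtrM// ler_wsqrtr.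
have x0 : x ^+ 2 = 0.
  apply/eqP; rewrite eq_le sqr_ge0 andbT (le_trans h)//.
  by rewrite mulr_le0_ge0 ?sqr_ge0// ltW.
by rewrite x0 sqrtr0 mulr_ge0 ?sqrtr_ge0.
Qed.

(** Since L+ dl = r - h phi' with r small against dl, the lower bound on L+ gives
    |dl|^2 <= K h^2. Then <phi, dl> = <psi, L+ dl> = - h <psi, phi'> + <psi, r>
    is - h <psi, phi> up to small terms, and the increment of the squared norm
    is 2 <phi, dl> + |dl|^2. *)
Lemma difference_quotient_bound (omega h e c0 K S : R) (psi : l2) : 0 < omega -> 0 < omega + h ->
  h != 0 -> 0 <= e -> 0 < c0 -> 4 * e ^+ 2 <= c0 ->
  (forall v, c0 * '[v, v] <= '[Lp omega v, Lp omega v]) ->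
  Lp omega psi = Phi omega ->
  (forall n, (s + 1) * `|(Phi (omega + h) n : R) `^ s - (Phi omega n : R) `^ s| <= e) ->
  '[Phi (omega + h) - Phi omega, Phi (omega + h) - Phi omega] <= 1 ->
  K = 4 / c0 * (2 * '[Phi omega, Phi omega] + 2) ->
  S = Num.sqrt ('[psi, psi] * K) ->
  `|h^-1 * ('[Phi (omega + h), Phi (omega + h)] - '[Phi omega, Phi omega])
    + 2 * '[psi, Phi omega]| <= (K + 2 * S) * `|h| + 2 * S * e.
Proof.
move=> o0 oh0 h0 e0 c00 ec0 hc0 psiE hpot.
have [dl dlE] : exists dl, dl = Phi (omega + h) - Phi omega by eexists.
have [r rE] : exists r, r = Lp omega dl + h *: Phi (omega + h) by eexists.
have hr := linearization_remainder o0 oh0 e0 hpot dlE rE.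
rewrite -dlE => dl1 KE SE.
have PhE : Phi (omega + h) = Phi omega + dl by rewrite dlE [RHS]addrC subrK.
have Ldl : Lp omega dl = r - h *: Phi (omega + h) by rewrite rE addrK.
have symL := lplus_sym sigma0 (umin o0).
move: (Phi (omega + h)) PhE Ldl psiE => Ph PhE Ldl psiE.
move: (Phi omega) (Lp omega) PhE Ldl psiE symL hc0 KE => P L PhE Ldl psiE symL hc0 KE.
have dl0 := dot_ge0 H dl.
have P0 := dot_ge0 H P.
have Pdl : '[P, dl] = - h * '[psi, Ph] + '[psi, r].
  by rewrite -psiE symL Ldl dotBr dotZr; ring.
have PhN : '[Ph, Ph] <= 2 * '[P, P] + 2.
  have := dot_sub_le H Ph P; have -> : Ph - P = dl by rewrite PhE addrC addKr.
  lra.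
have K0 : 0 <= K.
  by rewrite KE; apply: mulr_ge0; [rewrite divr_ge0// ltW|lra].
have dlK : '[dl, dl] <= K * h ^+ 2.
  have h1 := hc0 dl.
  have h2 : '[L dl, L dl] <= 2 * '[r, r] + 2 * h ^+ 2 * '[Ph, Ph].
    have := dot_ge0 H (r + h *: Ph); rewrite Ldl.
    rewrite !dotE (dotC H Ph r) expr2; lra.
  have h3 : h ^+ 2 * '[Ph, Ph] <= h ^+ 2 * (2 * '[P, P] + 2) by rewrite ler_wpM2l ?sqr_ge0.
  have h4 : 4 * (e ^+ 2 * '[dl, dl]) <= c0 * '[dl, dl] by rewrite mulrA ler_wpM2r.
  rewrite -(ler_pM2l c00).
  have -> : c0 * (K * h ^+ 2) = 4 * (h ^+ 2 * (2 * '[P, P] + 2)).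
    by rewrite KE; field; rewrite gt_eqF.
  lra.
have hN : 0 <= `|h| by [].
have hh : `|h| ^+ 2 = h ^+ 2 by rewrite real_normK ?num_real.
have psi0 := dot_ge0 H psi.
have Sr : `|'[psi, r]| <= S * (e * `|h|).
  rewrite SE; apply: norm_le_sqrt; first exact: mulr_ge0.
  apply: le_trans (dot_schwarz H psi r) _; rewrite -mulrA ler_wpM2l//.
  apply: le_trans hr _; rewrite exprMn hh mulrCA.
  by rewrite ler_wpM2l// sqr_ge0.
have Sd : `|'[psi, dl]| <= S * `|h|.
  rewrite SE; apply: norm_le_sqrt => //; apply: le_trans (dot_schwarz H psi dl) _.
  by rewrite -mulrA ler_wpM2l// hh.
have -> : h^-1 * ('[Ph, Ph] - '[P, P]) + 2 * '[psi, P] =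
    h^-1 * '[dl, dl] + h^-1 * (2 * '[psi, r]) - 2 * '[psi, dl].
  have -> : '[Ph, Ph] - '[P, P] = '[dl, dl] + 2 * '[P, dl].
    by rewrite PhE !(dotDl, dotDr) (dotC H dl P); ring.
  by rewrite Pdl PhE dotDr; field.
have h1 : `|h^-1 * '[dl, dl]| <= K * `|h|.
  rewrite normrM normfV (ger0_norm dl0) mulrC ler_pdivrMr ?normr_gt0//.
  by rewrite -mulrA -expr2 hh.
have h2 : `|h^-1 * (2 * '[psi, r])| <= 2 * S * e.
  rewrite normrM normfV normrM ger0_norm// mulrC ler_pdivrMr ?normr_gt0//.
  by rewrite -!mulrA ler_pM2l.
have h3 : `|2 * '[psi, dl]| <= 2 * S * `|h|.
  by rewrite normrM ger0_norm// -mulrA ler_pM2l.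
apply: le_trans (ler_normB _ _) _; apply: le_trans (lerD (ler_normD _ _) (lexx _)) _.
lra.
Qed.

Lemma sqr_lp_norm_wave (x : R) : 0 < x ->
  lp_norm 2 (embed (wave sigma u x)) ^+ 2 = '[Phi x, Phi x].
Proof. by move=> x0; rewrite embed_wave// lp_norm_embed sqr_sqrtr// dot_ge0. Qed.

Lemma lp_norm_increment (x y : R) : 0 < x -> 0 < y ->
  lp_norm 2 (fun n => embed (wave sigma u x) n - embed (wave sigma u y) n) =
  Num.sqrt '[Phi x - Phi y, Phi x - Phi y].
Proof.
move=> x0 y0; rewrite -lp_norm_embed; congr lp_norm; apply/funext => n.
by rewrite !embed_wave// /embed -rmorphB.
Qed.

Lemma is_derive_sqr_norm (omega : R) (psi : l2) : 0 < omega ->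
  lp_norm 2 (fun n => embed (wave sigma u x) n - embed (wave sigma u omega) n)
    @[x --> omega] --> (0 : R) ->
  (forall v, Lp omega v = 0 -> v = 0) -> Lp omega psi = Phi omega ->
  is_derive omega (1 : R) (fun x => lp_norm 2 (embed (wave sigma u x)) ^+ 2)
    (- (2 * '[psi, Phi omega])).
Proof.
move=> o0 cont inj psiE.
have vk := wave_vk_pair sigma0 o0 (umin o0) inj.
have [gs tail] := vk_tailp vk.
have [c0 c00 hc0] := injective_bounded_below (vk_symp vk) tail inj.
pose K := 4 / c0 * (2 * '[Phi omega, Phi omega] + 2).
pose S := Num.sqrt ('[psi, psi] * K).
have P0 := dot_ge0 H (Phi omega).
have K0 : 0 <= K by apply: mulr_ge0; [rewrite divr_ge0// ltW|lra].
have S0 : 0 <= S by exact: sqrtr_ge0.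
have s1 : 0 < s + 1 by rewrite addr_gt0.
set f := fun x : R => lp_norm 2 _ ^+ 2.
suff lim : h^-1 *: (f (h *: 1 + omega) - f omega) @[h --> 0^'] -->
    - (2 * '[psi, Phi omega]).
  by split; [apply/cvg_ex; eexists; exact: lim|exact: cvg_lim lim].
apply/cvgrPdist_le => e e0.
pose e' := Num.min (Num.sqrt c0 / 2) (e / (4 * (S + 1))).
have S1 : 0 < S + 1 by rewrite ltr_wpDl.
have e'0 : 0 < e' by rewrite lt_min !divr_gt0 ?sqrtr_gt0// mulr_gt0.
have e'c : 4 * e' ^+ 2 <= c0.
  have : e' ^+ 2 <= (Num.sqrt c0 / 2) ^+ 2.
    by rewrite lerXn2r ?nnegrE ?(ltW e'0) ?divr_ge0 ?sqrtr_ge0// ge_min lexx.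
  rewrite expr_div_n sqr_sqrtr ?(ltW c00)// (_ : 2 ^+ 2 = 4 :> R); last by ring.
  by rewrite ler_pdivlMr// mulrC.
have e'e : 2 * S * e' <= e / 2.
  have : e' * (4 * (S + 1)) <= e by rewrite -ler_pdivlMr ?mulr_gt0// ge_min lexx orbT.
  by move: (ltW e'0) => h1 h2; lra.
pose M := Num.sqrt '[Phi omega, Phi omega] + 1.
have [eta eta0 heta] := powR_uniform_continuous M s0 (divr_gt0 e'0 s1).
have : \forall x \near omega, 0 < x /\
    lp_norm 2 (fun n => embed (wave sigma u x) n - embed (wave sigma u omega) n)
      <= Num.min eta 1.
  near=> x; split.
    by near: x; exact: lt_nbhsr.
  near: x; have m0 : 0 < Num.min eta 1 by rewrite lt_min eta0 ltr01.
  move/cvgrPdist_le : cont => /(_ _ m0); apply: filterS => x.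
  by rewrite sub0r normrN; apply: le_trans; exact: ler_norm.
move=> /nbhs_ballP[r /= r0 hr].
pose r1 := e / (2 * (K + 2 * S + 1)).
have KS : 0 < K + 2 * S + 1 by rewrite ltr_wpDl// addr_ge0// mulr_ge0.
have r10 : 0 < r1 by rewrite divr_gt0// mulr_gt0.
exists (Num.min r r1); first by rewrite /= lt_min r0.
move=> h /=; rewrite sub0r normrN lt_min => /andP[hr0 hr1] h0.
have oh : h *: 1 + omega = omega + h by rewrite -[h *: 1]/(h * 1) mulr1 addrC.
have [oh0] : 0 < omega + h /\ lp_norm 2 (fun n => embed (wave sigma u (omega + h)) n -
    embed (wave sigma u omega) n) <= Num.min eta 1.
  by apply: hr; rewrite /ball/= opprD addrA subrr add0r normrN.
rewrite lp_norm_increment// le_min => /andP[dleta dl1].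
have coord n : `|(Phi (omega + h) n : R) - Phi omega n| <=
    Num.sqrt '[Phi (omega + h) - Phi omega, Phi (omega + h) - Phi omega].
  by rewrite -l2N -l2D; exact: coord_le_norm.
have hpot n : (s + 1) * `|(Phi (omega + h) n : R) `^ s - (Phi omega n : R) `^ s| <= e'.
  rewrite mulrC -ler_pdivlMr//; have := coord n.
  have := coord_le_norm (Phi omega) n.
  have := wave_l2_ge0 (umin o0) n; have := wave_l2_ge0 (umin oh0) n.
  move: (Phi omega n : R) (Phi (omega + h) n : R) => x y y0 x0 xN yN.
  have xM : x <= M by rewrite (le_trans (ler_norm _))// (le_trans xN)// lerDl.
  apply: heta; rewrite ?x0 ?y0 ?xM//=; last exact: le_trans dleta.
  have := le_trans (le_trans (ler_norm _) yN) dl1.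
  by have := le_trans (ler_norm _) xN; rewrite /M; lra.
have dl1' : '[Phi (omega + h) - Phi omega, Phi (omega + h) - Phi omega] <= 1.
  rewrite -(sqr_sqrtr (dot_ge0 H _)) -[leRHS](expr1n _ 2).
  by rewrite lerXn2r ?nnegrE ?sqrtr_ge0.
have := difference_quotient_bound o0 oh0 h0 (ltW e'0) c00 e'c hc0 psiE hpot dl1'
  (erefl K) (erefl S).
move=> hq; rewrite oh.
have -> : f (omega + h) - f omega =
    '[Phi (omega + h), Phi (omega + h)] - '[Phi omega, Phi omega].
  by congr (_ - _); exact: sqr_lp_norm_wave.
rewrite -normrN opprB opprK; apply: le_trans hq _.
have : (K + 2 * S) * `|h| <= e / 2.
  have : (K + 2 * S + 1) * `|h| <= (K + 2 * S + 1) * r1.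
    by rewrite ler_wpM2l ?(ltW KS) ?(ltW hr1).
  have -> : (K + 2 * S + 1) * r1 = e / 2 by rewrite /r1; field; rewrite gt_eqF.
  by have := normr_ge0 h; lra.
lra.
Unshelve. all: by end_near. Qed.

Lemma derivable_norm (omega l : R) : 0 < omega ->
  is_derive omega (1 : R) (fun x => lp_norm 2 (embed (wave sigma u x)) ^+ 2) l ->
  derivable (fun x => lp_norm 2 (embed (wave sigma u x))) omega 1.
Proof.
move=> o0 df.
have N0 : 0 < lp_norm 2 (embed (wave sigma u omega)) ^+ 2.
  by rewrite sqr_lp_norm_wave//; exact/dot_gt0/(wave_l2_neq0 sigma0 o0 (umin o0)).
have -> : (fun x => lp_norm 2 (embed (wave sigma u x))) =
    Num.sqrt \o (fun x => lp_norm 2 (embed (wave sigma u x)) ^+ 2).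
  by apply/funext => x; rewrite /= sqrtr_sqr ger0_norm// powR_ge0.
have ds := is_derive1_sqrt N0.
by have [] := @is_derive1_comp _ Num.sqrt
  (fun x => lp_norm 2 (embed (wave sigma u x)) ^+ 2) omega _ _ ds df.
Qed.

(** A real kernel element is in particular a complex one. *)
Lemma nondegenerate_inj (omega : R) : 0 < omega ->
  nondegenerate_wave sigma omega (wave sigma u omega) ->
  forall v, Lp omega v = 0 -> v = 0.
Proof.
move=> o0 nd v Lv.
have : [set v | in_l2 v /\ Lplus sigma omega (wave sigma u omega) v = fun=> 0] (embed v).
  split; first exact: in_l2_embed_l2.
  apply/funext => n; rewrite LplusE.
  have -> : (fun n => (2 * sigma + 1) * wave sigma u omega n `^ (2 * sigma)) =
     (fun n => (s + 1) * wave_pot sigma omega (u omega) n).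
    by apply/funext => k; rewrite /wave_pot wave_l2E.
  rewrite (schrC_embed _ _ _ (scaled_wave_pot_bounded sigma0 (umin o0))).
  by move: (congr1 (fun v : l2 => v n : R) Lv); rewrite /lplus => ->.
rewrite nd /= => v0; apply: l2_inj => n.
by have := congr1 (fun z => complex.Re (z n)) v0.
Qed.

(** The real and imaginary parts of a complex eigenvector are the four vectors
    of [vk_stable]; conversely [vk_unstable] gives a real eigenvector. *)
Lemma stable_wave (omega : R) (psi : l2) : 0 < omega ->
  (forall v, Lp omega v = 0 -> v = 0) -> Lp omega psi = Phi omega ->
  spectrally_stable sigma omega (wave sigma u omega) <-> '[psi, Phi omega] <= 0.
Proof.
move=> o0 inj psiE; have vk := wave_vk_pair sigma0 o0 (umin o0) inj.
have bm := wave_pot_bounded sigma0 (umin o0).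
have bp := scaled_wave_pot_bounded sigma0 (umin o0).
have potE : (fun n => wave sigma u omega n `^ (2 * sigma)) =
    wave_pot sigma omega (u omega).
  by apply/funext => k; rewrite /wave_pot wave_l2E.
have potE' : (fun n => (2 * sigma + 1) * wave sigma u omega n `^ (2 * sigma)) =
    (fun n => (s + 1) * wave_pot sigma omega (u omega) n).
  by apply/funext => k; rewrite -potE.
split=> [stable|D0 [mu [z1 [z2 [mu0 [zl1 zl2] z0 e1 e2]]]]].
  rewrite leNgt; apply/negP => D0; apply: stable.
  have [mu [v1 [v2 [mu0 v10 h1 h2]]]] := vk_unstable vk psiE D0.
  exists mu%:C%C, (embed v1), (embed v2); split=> //.
  - by split; exact: in_l2_embed_l2.
  - move=> [v1e _]; move/eqP: v10; apply; apply: l2_inj => n.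
    by have := congr1 (fun z => complex.Re (z n)) v1e.
  - move=> n; rewrite LminusE potE (schrC_embed _ _ _ bm).
    have := congr1 (fun v : l2 => v n : R) h1; rewrite l2N l2Z /lminus.
    by rewrite /embed -rmorphN -rmorphM => ->.
  - move=> n; rewrite LplusE potE' (schrC_embed _ _ _ bp).
    have := congr1 (fun v : l2 => v n : R) h2; rewrite l2Z /lplus.
    by rewrite /embed -rmorphM => ->.
have [] := @vk_stable _ _ H _ _ _ psi (complex.Re mu) (complex.Im mu)
  (reS z1) (imS z1) (reS z2) (imS z2) vk psiE D0 mu0.
- apply: l2_inj => n.
  rewrite -[RHS]/(- (complex.Re mu * reS z1 n - complex.Im mu * imS z1 n) : R).
  rewrite reSE// imSE// -cReM -e1 cReN opprK LminusE potE.
  by rewrite (schrC_re _ _ bm).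
- apply: l2_inj => n.
  rewrite -[RHS]/(- (complex.Im mu * reS z1 n + complex.Re mu * imS z1 n) : R).
  rewrite reSE// imSE// addrC -cImM -e1 cImN opprK LminusE potE.
  by rewrite (schrC_im _ _ bm).
- apply: l2_inj => n.
  rewrite -[RHS]/(complex.Re mu * reS z2 n - complex.Im mu * imS z2 n : R).
  rewrite reSE// imSE// -cReM -e2 LplusE potE'.
  by rewrite (schrC_re _ _ bp).
- apply: l2_inj => n.
  rewrite -[RHS]/(complex.Im mu * reS z2 n + complex.Re mu * imS z2 n : R).
  rewrite reSE// imSE// addrC -cImM -e2 LplusE potE'.
  by rewrite (schrC_im _ _ bp).
move=> a0 b0 c0 d0; apply: z0; congr pair; apply/funext => n.
- have := congr1 (fun v : l2 => v n : R) a0; have := congr1 (fun v : l2 => v n : R) b0.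
  by rewrite reSE// imSE// l20; case: (z1 n) => x y /= -> ->.
- have := congr1 (fun v : l2 => v n : R) c0; have := congr1 (fun v : l2 => v n : R) d0.
  by rewrite reSE// imSE// l20; case: (z2 n) => x y /= -> ->.
Qed.

End Frequency.

Theorem corollary1 (R : realType) (d : nat) (sigma : R) (a b : \bar R)
    (u : R -> lattice d -> R) :
  (1 <= d)%N -> 0 < sigma ->
  [set omega : R | (a < omega%:E < b)%E] `<=` [set omega : R | 0 < omega] ->
  (forall omega : R, 0 < omega -> nonneg_minimizer sigma omega (u omega)) ->
  l2_continuous_on [set omega : R | (a < omega%:E < b)%E] (wave sigma u) ->
  (forall omega : R, (a < omega%:E < b)%E ->
     nondegenerate_wave sigma omega (wave sigma u omega)) ->
  forall omega : R, (a < omega%:E < b)%E ->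
    derivable (fun x : R => lp_norm 2 (embed (wave sigma u x))) omega 1 /\
    (spectrally_stable sigma omega (wave sigma u omega) <->
     0 <= derive1 (fun x : R => lp_norm 2 (embed (wave sigma u x)) ^+ 2) omega).
Proof.
move=> _ sigma0 pos umin cont nondeg omega omegaI.
have o0 : 0 < omega := pos _ omegaI.
have inj := nondegenerate_inj sigma0 umin o0 (nondeg _ omegaI).
have vk := wave_vk_pair sigma0 o0 (umin _ o0) inj.
have [gs tail] := vk_tailp vk.
have [psi psiE] := injective_surjective (wave_l2 sigma omega (u omega))
  (vk_symp vk) tail inj.
have df := is_derive_sqr_norm sigma0 umin o0 (cont _ omegaI) inj psiE.
split; first exact: derivable_norm df.
rewrite (stable_wave sigma0 umin o0 inj psiE) derive1E.
have -> := @derive_val _ _ _ _ _ _ _ df.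
by rewrite oppr_ge0 pmulr_rle0.
Qed.
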